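(* Let $H$ be a finite dimensional Hopf algebra over a field $k$, and let $r=r^1\otimes r^2\in H\otimes H$ be an invertible element with inverse $r^{-1}=u^1\otimes u^2$. Let $\mathcal{R}^1\otimes\mathcal{R}^2$ denote another copy of $r$, and assume that $$\Delta(r^1)\otimes r^2=\mathcal{R}^1\otimes r^1\otimes \mathcal{R}^2r^2,$$ $$r^1\otimes\Delta(r^2)=\mathcal{R}^1r^1\otimes r^2\otimes\mathcal{R}^2,$$ $$\mathcal{R}^1\otimes\mathcal{R}^2_2r^1\otimes\mathcal{R}^2_1r^2=\mathcal{R}^1\otimes r^1\mathcal{R}^2_1\otimes r^2\mathcal{R}^2_2$$ in $H\otimes H\otimes H$. Then: (1) The vector space $H^*$ with the multiplication $$\varphi*\varphi'=(\varphi\leftharpoonup S^{-1}(r^1))\,(r^2_1\rightharpoonup\varphi'\leftharpoonup S^{-1}(r^2_2)),\qquad \varphi,\varphi'\in H^*,$$ (where the product on the right-hand side is the ordinary convolution product of $H^*$) is an associative algebra with unit $\varepsilon$; denote it by $\underline{H}^*$. (2) The linear map $$R':H\otimes\underline{H}^*\to\underline{H}^*\otimes H,\qquad R'(h\otimes\varphi)=h_1\rightharpoonup\varphi\leftharpoonup S^{-1}(u^1h_3r^1)\otimes u^2h_2r^2,$$ is a twisting map between $\underline{H}^*$ and $H$. (3) The linear map $$\underline{H}^*\otimes_{R'}H\to D(H),\qquad \varphi\otimes h\mapsto \varphi\leftharpoonup S^{-1}(r^1)\otimes r^2h,$$ is an algebra isomorphism from the twisted tensor product $\underline{H}^*\otimes_{R'}H$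 to the Drinfeld double $D(H)$. In particular, $D(H)$ is isomorphic as an algebra to a twisted tensor product between $\underline{H}^*$ and $H$.
   Context: All algebras, linear spaces and tensor products are over a field $k$; ''algebra'' means associative unital algebra. Hopf algebra notation: $H$ has comultiplication $\Delta(h)=h_1\otimes h_2$ (Sweedler notation, summation understood; $h_1\otimes h_2\otimes h_3$ is the iterated comultiplication), counit $\varepsilon$ and antipode $S$ (bijective, since $H$ is finite dimensional). For an element $r=r^1\otimes r^2\in H\otimes H$ summation is understood, and subscripts denote comultiplication of the corresponding tensor component, e.g. $\Delta(r^2)=r^2_1\otimes r^2_2$. Invertibility of $r$ is in the algebra $H\otimes H$. The ordinary algebra structure on $H^*$ is the convolution product $(\varphi\varphi')(x)=\varphi(x_1)\varphi'(x_2)$ with unit $\varepsilon$. The regular actions of $H$ on $H^*$ are $(h\rightharpoonup\varphi)(x)=\varphi(xh)$ and $(\varphi\leftharpoonup h)(x)=\varphi(hx)$, for $h,x\in H$, $\varphi\in H^*$. The Drinfeld double $D(H)$ is the vector space $H^*\otimes H$ with unit $\varepsilon\otimes 1$ and multiplication $$(\varphi\otimes h)(\varphi'\otimes h')=\varphi\,(h_1\rightharpoonup\varphi'\leftharpoonup S^{-1}(h_3))\otimes h_2h',$$ for $h,h'\in H$, $\varphi,\varphi'\in H^*$. Twisting maps: given algebras $A,B$, a linear map $R:B\otimes A\to A\otimes B$, written $R(b\otimes a)=a_R\otimes b_R$ (summation understood), is called a twisting map between $A$ and $B$ if for all $a,a'\in A$, $b,b'\in B$ (with $r$ here denoting another copy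 of the map $R$): $a_R\otimes 1_R=a\otimes 1$; $1_R\otimes b_R=1\otimes b$; $(aa')_R\otimes b_R=a_Ra'_r\otimes b_{R_r}$; $a_R\otimes(bb')_R=a_{R_r}\otimes b_rb'_R$. In that case the multiplication $(a\otimes b)(a'\otimes b')=aa'_R\otimes b_Rb'$ on $A\otimes B$ is associative with unit $1\otimes1$; the resulting algebra is denoted $A\otimes_RB$ and called the twisted tensor product of $A$ and $B$ afforded by $R$. *)

(* Defs.v *)
From HB Require Import structures.
From mathcomp Require Import all_boot all_order all_algebra all_field.

Set Implicit Arguments.
Unset Strict Implicit.
Unset Printing Implicit Defensive.

Import GRing.Theory VectorInternalTheory.
Local Open Scope ring_scope.

(* The tensor product of two finite dimensional spaces, as the space of
   coordinate matrices in the bases underlying V and W. *)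
Definition tens (k : fieldType) (V W : vectType k) : Type :=
  'M[k]_(dim V, dim W).

HB.instance Definition _ (k : fieldType) (V W : vectType k) :=
  Vector.copy (tens V W) 'M[k]_(dim V, dim W).
HB.instance Definition _ (k : fieldType) (V W : vectType k) :=
  SemiVector.on (tens V W).

Definition tpure (k : fieldType) (V W : vectType k) (v : V) (w : W) : tens V W :=
  (v2r v)^T *m v2r w.

Notation "v \ox w" := (tpure v w) (at level 45, right associativity) : ring_scope.

(* The linear map induced by a bilinear f (see tliftE), computed on coordinates;
   it is linear for any f. *)
Definition tlift (k : fieldType) (V W U : vectType k) (f : V -> W -> U)
    (t : tens V W) : U :=
  \sum_(i < dim V) \sum_(j < dim W)
    (t : 'M[k]_(dim V, dim W)) i j *:
      f (r2v (delta_mx 0 i)) (r2v (delta_mx 0 j)).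

(* Sweedler notation: \sw_(a, b <- t) E stands for E in a = t^1, b = t^2,
   summation understood. It decomposes t over the basis tensors, which for E
   bilinear in (a, b) gives the same value as any other decomposition.
   \sw_(a, b, c <- t) E does the same for t in V (x) (W (x) Z). *)
Definition tsum (k : fieldType) (V W U : vectType k) (t : tens V W)
    (f : V -> W -> U) : U := tlift f t.

Notation "\sw_ ( a , b <- t ) E" := (tsum t (fun a b => E))
  (at level 46, right associativity, a name, b name, t at level 46,
   E at level 46, format "\sw_ ( a ,  b  <-  t )  E") : ring_scope.
Notation "\sw_ ( a , b , c <- t ) E" :=
  (tsum t (fun a bc => tsum bc (fun b c => E)))
  (at level 46, right associativity, a name, b name, c name, t at level 46,
   E at level 46, format "\sw_ ( a ,  b ,  c  <-  t )  E") : ring_scope.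

Section TensorTheory.
Variable k : fieldType.
Implicit Types U V W : vectType k.

Lemma linfunE V W (f : V -> W) : linear f -> linfun f =1 f.
Proof.
move=> flin.
pose F : {linear V -> W} := HB.pack f (GRing.isLinear.Build k V W _ f flin).
exact: (lfunE F).
Qed.

Lemma tlift_is_linear V W U (f : V -> W -> U) : linear (tlift f).
Proof.
move=> a s t; rewrite /tlift scaler_sumr -big_split; apply: eq_bigr => i _ /=.
rewrite scaler_sumr -big_split; apply: eq_bigr => j _ /=.
by rewrite !mxE scalerDl scalerA.
Qed.

HB.instance Definition _ V W U (f : V -> W -> U) :=
  GRing.isLinear.Build k (tens V W) U _ (tlift f) (tlift_is_linear f).

Lemma tpure_bilinear V W : bilinear_for *:%R *:%R (@tpure k V W).
Proof.
split=> [w a v v'|v a w w']; rewrite /tpure.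
  by rewrite linearP /= linearP /= mulmxDl -scalemxAl.
by rewrite linearP /= mulmxDr -scalemxAr.
Qed.

HB.instance Definition _ V W :=
  bilinear_isBilinear.Build k V W (tens V W) _ _ (@tpure k V W)
    (@tpure_bilinear V W).

Lemma r2v_sum V (v : V) : v = \sum_i v2r v 0 i *: r2v (delta_mx 0 i).
Proof.
rewrite -[LHS]v2rK {1}[v2r v]row_sum_delta linear_sum.
by apply: eq_bigr => i _; rewrite linearZ.
Qed.

Lemma tliftE V W U (f : V -> W -> U) v w :
  bilinear_for *:%R *:%R f -> tlift f (v \ox w) = f v w.
Proof.
move=> [fl fr].
pose g w' : {linear V -> U} := HB.pack (f^~ w')
  (GRing.isLinear.Build k V U _ (f^~ w') (fl w')).
pose h v' : {linear W -> U} := HB.pack (f v')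
  (GRing.isLinear.Build k W U _ (f v') (fr v')).
rewrite {2}[v]r2v_sum -[RHS]/(g w _) linear_sum.
apply: eq_bigr => i _; rewrite linearZ /= -[f _ w]/(h _ w).
rewrite {2}[w]r2v_sum linear_sum scaler_sumr; apply: eq_bigr => j _.
by rewrite linearZ /= scalerA /tpure !mxE big_ord1 mxE.
Qed.

Lemma tsumE V W U (f : V -> W -> U) v w :
  bilinear_for *:%R *:%R f -> \sw_(a, b <- v \ox w) f a b = f v w.
Proof. exact: tliftE. Qed.

Lemma tsum_tpure V W (t : tens V W) : \sw_(v, w <- t) (v \ox w) = t.
Proof.
rewrite [RHS](matrix_sum_delta t); apply: eq_bigr => i _; apply: eq_bigr => j _.
by rewrite /tpure !r2vK trmx_delta mul_delta_mx.
Qed.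

Lemma tens_ind V W (P : tens V W -> Prop) :
    (forall v w, P (v \ox w)) ->
    (forall a s t, P s -> P t -> P (a *: s + t)) ->
  forall t, P t.
Proof.
move=> Ppure Plin t.
have P0 : P 0.
  by rewrite -(addNr (0 \ox 0)) -scaleN1r; apply: Plin; apply: Ppure.
have PD s u : P s -> P u -> P (s + u).
  by move=> Ps Pu; have := Plin 1 s u Ps Pu; rewrite scale1r.
rewrite -[t]tsum_tpure; apply: (big_ind P) => // i _; apply: (big_ind P) => // j _.
by rewrite -[_ *: _]addr0; apply: Plin.
Qed.

Lemma tsum_linear_param (P : lmodType k) V W U (f : P -> V -> W -> U) t :
  (forall v w, linear (fun p : P => f p v w)) ->
  linear (fun p => \sw_(v, w <- t) f p v w).
Proof.
move=> flin a p q; rewrite /tsum /tlift scaler_sumr -big_split.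
apply: eq_bigr => i _; rewrite scaler_sumr -big_split; apply: eq_bigr => j _ /=.
by rewrite flin scalerDr !scalerA mulrC.
Qed.

Lemma tpure_neq0 V W (v : V) (w : W) : v != 0 -> w != 0 -> v \ox w != 0.
Proof.
have nz (Z : vectType k) (z : Z) : z != 0 -> exists i, v2r z 0 i != 0.
  move=> z_neq0; apply/existsP; apply: contraNT z_neq0.
  rewrite negb_exists => /forallP z0; apply/eqP/v2r_inj; rewrite linear0.
  by apply/rowP=> i; rewrite mxE; apply/eqP; have := z0 i; rewrite negbK.
move=> /nz[i vi] /nz[j wj]; apply/eqP => /matrixP/(_ i j)/eqP.
by rewrite !mxE big_ord1 mxE mulf_eq0 (negPf vi) (negPf wj).
Qed.

End TensorTheory.

Section TensorAlgebra.
Variables (k : fieldType) (A B : falgType k).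

Definition tens_one : tens A B := 1 \ox 1.

Definition tens_mul (s t : tens A B) : tens A B :=
  \sw_(a, b <- s) \sw_(a', b' <- t) (a * a') \ox (b * b').

Let mul_linearl t : linear (tens_mul^~ t).
Proof. exact: tlift_is_linear. Qed.

Let mul_linearr s : linear (tens_mul s).
Proof. by apply: tsum_linear_param => a b; exact: tlift_is_linear. Qed.

Lemma tens_mulE a b a' b' :
  tens_mul (a \ox b) (a' \ox b') = (a * a') \ox (b * b').
Proof.
have bil (c : A) (d : B) : bilinear_for *:%R *:%R
    (fun c' d' => (c * c') \ox (d * d') : tens A B).
  split=> [d' x u v | c' x u v] /=; rewrite /applyr /= mulrDr -scalerAr.
    exact: linearPl.
  exact: linearPr.
rewrite /tens_mul tsumE; first by rewrite tsumE //; exact: bil.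
split=> [d|c]; apply: tsum_linear_param => c' d' x u v.
  by rewrite mulrDl -scalerAl linearPl.
by rewrite mulrDl -scalerAl linearPr.
Qed.

Let mulA : associative tens_mul.
Proof.
move=> s t u; elim/tens_ind: s => [a b|x s s' IHs IHs']; last first.
  by rewrite !mul_linearl IHs IHs'.
elim/tens_ind: t => [a' b'|x t t' IHt IHt']; last first.
  by rewrite !(mul_linearl, mul_linearr) IHt IHt'.
elim/tens_ind: u => [c d|x u u' IHu IHu']; last first.
  by rewrite !mul_linearr IHu IHu'.
by rewrite !tens_mulE !mulrA.
Qed.

Let mul1 : left_id tens_one tens_mul.
Proof.
elim/tens_ind=> [a b|x s s' IHs IHs']; last by rewrite mul_linearr IHs IHs'.
by rewrite tens_mulE !mul1r.
Qed.

Let mulr1 : right_id tens_one tens_mul.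
Proof.
elim/tens_ind=> [a b|x s s' IHs IHs']; last by rewrite mul_linearl IHs IHs'.
by rewrite tens_mulE !GRing.mulr1.
Qed.

Let mulDl : left_distributive tens_mul +%R.
Proof. by move=> s t u; have := mul_linearl u 1 s t; rewrite !scale1r. Qed.

Let mulDr : right_distributive tens_mul +%R.
Proof. by move=> s t u; have := mul_linearr s 1 t u; rewrite !scale1r. Qed.

Let one_neq0 : tens_one != 0.
Proof. by apply: tpure_neq0; exact: oner_neq0. Qed.

HB.instance Definition _ := GRing.Zmodule_isNzRing.Build (tens A B)
  mulA mul1 mulr1 mulDl mulDr one_neq0.

Let scaleAl x (s t : tens A B) : x *: (s * t) = (x *: s) * t.
Proof. rewrite -[x *: s]addr0 [RHS]mul_linearl -[tens_mul 0 t]/(0 * t).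
by rewrite mul0r addr0. Qed.

Let scaleAr x (s t : tens A B) : x *: (s * t) = s * (x *: t).
Proof. rewrite -[x *: t]addr0 [RHS]mul_linearr -[tens_mul s 0]/(s * 0).
by rewrite mulr0 addr0. Qed.

HB.instance Definition _ :=
  GRing.Lmodule_isLalgebra.Build k (tens A B) scaleAl.
HB.instance Definition _ := GRing.Lalgebra_isAlgebra.Build k (tens A B) scaleAr.
HB.instance Definition _ := Algebra_isFalgebra.Build k (tens A B).

End TensorAlgebra.

Record finHopfAlgType (k : fieldType) := FinHopfAlg {
  hopf_sort :> falgType k;
  comul : {lrmorphism hopf_sort -> tens hopf_sort hopf_sort};
  counit : {lrmorphism hopf_sort -> k^o};
  antipode : {linear hopf_sort -> hopf_sort};
  comulA (h : hopf_sort) :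
    \sw_(h1, h2 <- comul h) \sw_(h21, h22 <- comul h2) h1 \ox h21 \ox h22 =
    \sw_(h1, h2 <- comul h) \sw_(h11, h12 <- comul h1) h11 \ox h12 \ox h2;
  counitl (h : hopf_sort) : \sw_(h1, h2 <- comul h) (counit h1 *: h2) = h;
  counitr (h : hopf_sort) : \sw_(h1, h2 <- comul h) (counit h2 *: h1) = h;
  antipodel (h : hopf_sort) : \sw_(h1, h2 <- comul h) (antipode h1 * h2) = (counit h)%:A;
  antipoder (h : hopf_sort) : \sw_(h1, h2 <- comul h) (h1 * antipode h2) = (counit h)%:A
}.

Arguments comul {k H} : rename.
Arguments counit {k H} : rename.
Arguments antipode {k H} : rename.

Section HopfOperations.
Variables (k : fieldType) (H : finHopfAlgType k).

Definition comul3 (h : H) : tens H (tens H H) :=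
  \sw_(h1, h2 <- comul h) \sw_(h21, h22 <- comul h2) h1 \ox h21 \ox h22.

Lemma comul3_is_linear : linear comul3.
Proof. by move=> a u v; rewrite /comul3 linearP; exact: tlift_is_linear. Qed.

(* S is bijective since H is finite dimensional, so that this pseudo-inverse
   of linear maps is the composition inverse of S. *)
Definition antipodeV : 'End(H) := (linfun (antipode (H := H)))^-1%VF.

End HopfOperations.

Notation dual V := 'Hom(V, GRing.regular _).

Section DualActions.
Variables (k : fieldType) (H : finHopfAlgType k).

Definition conv_one : dual H := linfun (counit (H := H)).

Definition conv (f g : dual H) : dual H :=
  linfun (fun x => \sw_(x1, x2 <- comul x) (f x1 * g x2) : k^o).

Definition lhit (h : H) (f : dual H) : dual H := linfun (fun x => f (x * h)).

Definition rhit (f : dual H) (h : H) : dual H := linfun (fun x => f (h * x)).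

Lemma convE f g x : conv f g x = \sw_(x1, x2 <- comul x) (f x1 * g x2).
Proof.
have lin : linear (fun x => \sw_(x1, x2 <- comul x) (f x1 * g x2) : k^o).
  by move=> a u v; rewrite linearP; exact: tlift_is_linear.
by rewrite linfunE.
Qed.

Lemma lhitE h f x : lhit h f x = f (x * h).
Proof.
have lin : linear (fun x => f (x * h)).
  by move=> a u v; rewrite mulrDl -scalerAl linearP.
by rewrite linfunE.
Qed.

Lemma rhitE f h x : rhit f h x = f (h * x).
Proof.
have lin : linear (fun x => f (h * x)).
  by move=> a u v; rewrite mulrDr -scalerAr linearP.
by rewrite linfunE.
Qed.

Lemma conv_bilinear : bilinear_for *:%R *:%R conv.
Proof.
split=> [g|f] a u v; apply/lfunP => x; rewrite /applyr add_lfunE scale_lfunE !convE.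
  have lin : linear (fun f : dual H =>
      \sw_(x1, x2 <- comul x) (f x1 * g x2) : k^o).
    apply: tsum_linear_param => y z b p q.
    by rewrite add_lfunE scale_lfunE mulrDl -scalerAl.
  exact: lin.
have lin : linear (fun g : dual H =>
    \sw_(x1, x2 <- comul x) (f x1 * g x2) : k^o).
  apply: tsum_linear_param => y z b p q.
  by rewrite add_lfunE scale_lfunE mulrDr -scalerAr.
exact: lin.
Qed.

Lemma lhit_bilinear : bilinear_for *:%R *:%R lhit.
Proof.
split=> [f|h] a u v; apply/lfunP => x; rewrite /applyr add_lfunE scale_lfunE !lhitE.
  by rewrite mulrDr -scalerAr linearP.
by rewrite add_lfunE scale_lfunE.
Qed.

Lemma rhit_bilinear : bilinear_for *:%R *:%R rhit.
Proof.
split=> [h|f] a u v; apply/lfunP => x; rewrite /applyr add_lfunE scale_lfunE !rhitE.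
  by rewrite add_lfunE scale_lfunE.
by rewrite mulrDl -scalerAl linearP.
Qed.

HB.instance Definition _ :=
  bilinear_isBilinear.Build k _ _ (dual H) _ _ conv conv_bilinear.
HB.instance Definition _ :=
  bilinear_isBilinear.Build k _ _ (dual H) _ _ lhit lhit_bilinear.
HB.instance Definition _ :=
  bilinear_isBilinear.Build k _ _ (dual H) _ _ rhit rhit_bilinear.

End DualActions.

Notation "h ⇀ f" := (lhit h f) (at level 35, right associativity) : ring_scope.
Notation "f ↼ h" := (rhit f h) (at level 38, left associativity) : ring_scope.

(* Candidate algebra structures on a space; the axioms are is_algebra. *)
Record alg_ops (k : fieldType) (V : vectType k) :=
  AlgOps { amul : V -> V -> V; aone : V }.

Definition is_algebra (k : fieldType) (V : vectType k) (A : alg_ops V) : Prop :=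
  [/\ bilinear_for *:%R *:%R (amul A), associative (amul A),
      left_id (aone A) (amul A) & right_id (aone A) (amul A)].

Definition is_alg_iso (k : fieldType) (V W : vectType k)
    (A : alg_ops V) (B : alg_ops W) (f : 'Hom(V, W)) : Prop :=
  [/\ is_algebra A, is_algebra B, bijective f, f (aone A) = aone B
    & {morph f : x y / amul A x y >-> amul B x y}].

Definition falg_ops (k : fieldType) (A : falgType k) : alg_ops A :=
  AlgOps *%R 1.

Section TwistedTensorProduct.
Variables (k : fieldType) (V W : vectType k) (A : alg_ops V) (B : alg_ops W).
Variable R : 'Hom(tens W V, tens V W).

Definition is_twisting_map : Prop :=
  [/\ forall a, R (aone B \ox a) = a \ox aone B,
      forall b, R (b \ox aone A) = aone A \ox b,
      forall a a' b, R (b \ox amul A a a') =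
        \sw_(aR, bR <- R (b \ox a)) \sw_(a'r, bRr <- R (bR \ox a'))
          amul A aR a'r \ox bRr
    & forall a b b', R (amul B b b' \ox a) =
        \sw_(aR, b'R <- R (b' \ox a)) \sw_(aRr, br <- R (b \ox aR))
          aRr \ox amul B br b'R].

Definition twisted_tensor : alg_ops (tens V W) :=
  AlgOps (fun x y =>
      \sw_(a, b <- x) \sw_(a', b' <- y) \sw_(a'R, bR <- R (b \ox a'))
        amul A a a'R \ox amul B bR b')
    (aone A \ox aone B).

Lemma twisted_tensorE a b a' b' :
    bilinear_for *:%R *:%R (amul A) -> bilinear_for *:%R *:%R (amul B) ->
  amul twisted_tensor (a \ox b) (a' \ox b') =
    \sw_(a'R, bR <- R (b \ox a')) amul A a a'R \ox amul B bR b'.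
Proof.
move=> [Al Ar] [Bl Br]; rewrite /= tsumE.
  rewrite tsumE //; split=> c x u v; rewrite /applyr.
    by rewrite linearPr linearP; exact: tlift_is_linear.
  apply: (@tsum_linear_param _ W V W _
    (fun b' a'R bR => amul A a a'R \ox amul B bR b')) => p q y z t.
  by rewrite Br linearPr.
split=> c.
  apply: tsum_linear_param => ? ?.
  apply: (@tsum_linear_param _ V V W) => ? ? x u v.
  by have := Al _ x u v; rewrite /applyr => ->; rewrite linearPl.
apply: tsum_linear_param => ? ? x u v.
by rewrite linearPl linearP; exact: tlift_is_linear.
Qed.

End TwistedTensorProduct.

Section DrinfeldDouble.
Variables (k : fieldType) (H : finHopfAlgType k).
Local Notation S' := (@antipodeV k H).

Definition drinfeld_double : alg_ops (tens (dual H) H) :=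
  AlgOps (fun x y =>
      \sw_(f, h <- x) \sw_(f', h' <- y) \sw_(h1, h2, h3 <- comul3 h)
        conv f (h1 ⇀ f' ↼ S' h3) \ox (h2 * h'))
    (conv_one H \ox 1).

Variable r : tens H H.

Definition underlined_dual : alg_ops (dual H) :=
  AlgOps (fun f f' =>
      \sw_(r1, r2 <- r) \sw_(r21, r22 <- comul r2)
        conv (f ↼ S' r1) (r21 ⇀ f' ↼ S' r22))
    (conv_one H).

Definition double_twist : 'Hom(tens H (dual H), tens (dual H) H) :=
  linfun (tlift (fun h f =>
    \sw_(h1, h2, h3 <- comul3 h) \sw_(u1, u2 <- r^-1) \sw_(r1, r2 <- r)
      (h1 ⇀ f ↼ S' (u1 * h3 * r1)) \ox (u2 * h2 * r2))).

Definition double_iso : 'Hom(tens (dual H) H, tens (dual H) H) :=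
  linfun (tlift (fun f h => \sw_(r1, r2 <- r) (f ↼ S' r1) \ox (r2 * h))).

Lemma double_twistE h f :
  double_twist (h \ox f) =
    \sw_(h1, h2, h3 <- comul3 h) \sw_(u1, u2 <- r^-1) \sw_(r1, r2 <- r)
      (h1 ⇀ f ↼ S' (u1 * h3 * r1)) \ox (u2 * h2 * r2).
Proof.
rewrite linfunE; last exact: tlift_is_linear.
rewrite tliftE //; split=> [g a u v|g]; rewrite /applyr.
  by rewrite comul3_is_linear; exact: tlift_is_linear.
do 2!apply: tsum_linear_param => ? ?.
apply: (@tsum_linear_param _ (dual H) H H _ _ (r^-1 : tens H H)) => ? ?.
apply: tsum_linear_param => ? ? a u v.
by rewrite linearPr linearPl linearPl.
Qed.

Lemma double_isoE f h :
  double_iso (f \ox h) = \sw_(r1, r2 <- r) (f ↼ S' r1) \ox (r2 * h).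
Proof.
rewrite linfunE; last exact: tlift_is_linear.
rewrite tliftE //; split=> g; apply: tsum_linear_param => x y a u v.
  by rewrite !linearPl.
by rewrite mulrDr -scalerAr linearPr.
Qed.

Lemma drinfeld_doubleE f h f' h' :
  amul drinfeld_double (f \ox h) (f' \ox h') =
    \sw_(h1, h2, h3 <- comul3 h) conv f (h1 ⇀ f' ↼ S' h3) \ox (h2 * h').
Proof.
rewrite /= tsumE; last first.
  split=> g; last first.
    apply: tsum_linear_param => x y a u v.
    by rewrite comul3_is_linear; exact: tlift_is_linear.
  apply: tsum_linear_param => ? ?.
  apply: (@tsum_linear_param _ (dual H) H (tens H H)) => ? ?.
  apply: tsum_linear_param => ? ? a u v.
  by rewrite linearPl linearPl.
rewrite tsumE //; split=> g.
  apply: (@tsum_linear_param _ (dual H) H (tens H H)) => ? ?.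
  apply: tsum_linear_param => ? ? a u v.
  by rewrite linearPr linearPl linearPr linearPl.
apply: (@tsum_linear_param _ H H (tens H H)) => ? ?.
apply: tsum_linear_param => ? ? a u v.
by rewrite mulrDr -scalerAr linearPr.
Qed.

End DrinfeldDouble.

(* Main.v *)
Require Import Defs.
From HB Require Import structures.
From mathcomp Require Import all_boot all_order all_algebra all_field.

Set Implicit Arguments.
Unset Strict Implicit.
Unset Printing Implicit Defensive.

Import GRing.Theory VectorInternalTheory.
Local Open Scope ring_scope.

(** The double D(H) contains H as {eps (x) h} and, since r is invertible, a copy
    of H^* as j(phi) = phi ↼ S^-1(r^1) (x) r^2. The identities on r say exactly
    that j(phi) j(phi') = j(phi * phi'), and phi (x) h |-> j(phi) h is bijective
    because it is the action of the invertible element r on H^* (x) H. So D(H)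
    factorizes through the two subalgebras, and any such factorization of an
    algebra is a twisted tensor product, R' being obtained by rewriting h j(phi)
    in the form sum j(phi') h'. That D(H) is associative rests on the
    bijectivity of S: H^* is a Hopf module over H, hence is generated by its
    coinvariants, and S(h) = 0 would force lam(x) h = 0 for every coinvariant lam. *)

(** * Sweedler calculus *)

Section Linearity.
Variable k : fieldType.

Lemma linear_id_fun (V : lmodType k) : linear (fun x : V => x).
Proof. by []. Qed.

Lemma linear_comp_fun (U V W : lmodType k) (f : V -> W) (g : U -> V) :
  linear f -> linear g -> linear (fun x => f (g x)).
Proof. by move=> fl gl a u v; rewrite gl fl. Qed.

Lemma linear_mulr (A : algType k) (c : A) : linear (fun x : A => c * x).
Proof. by move=> a u v; rewrite mulrDr -scalerAr. Qed.

Lemma linear_mull (A : algType k) (c : A) : linear (fun x : A => x * c).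
Proof. by move=> a u v; rewrite mulrDl -scalerAl. Qed.

Lemma linear_scaler (V : lmodType k) (c : k) : linear (fun x : V => c *: x).
Proof. by move=> a u v; rewrite scalerDr !scalerA mulrC. Qed.

Lemma linear_scalel (V : lmodType k) (w : V) : linear (fun c : k^o => c *: w).
Proof. by move=> a u v; rewrite scalerDl scalerA. Qed.

Lemma linear_tpurer (V W : vectType k) (v : V) : linear (fun w : W => v \ox w).
Proof. exact: linearPr. Qed.

Lemma linear_tpurel (V W : vectType k) (w : W) : linear (fun v : V => v \ox w).
Proof. exact: linearPl. Qed.

Lemma linear_lfunl (V W : vectType k) (v : V) : linear (fun f : 'Hom(V, W) => f v).
Proof. by move=> a u v'; rewrite add_lfunE scale_lfunE. Qed.

Lemma linear_lfunr (V W : vectType k) (f : 'Hom(V, W)) : linear f.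
Proof. exact: linearP. Qed.

Lemma linear_tsum (V W U : vectType k) (f : V -> W -> U) :
  linear (fun t => tsum t f).
Proof. exact: tlift_is_linear. Qed.

Variable H : finHopfAlgType k.

Lemma linear_convl (g : dual H) : linear (fun f => conv f g).
Proof. exact: (@conv_bilinear k H).1. Qed.
Lemma linear_convr (f : dual H) : linear (fun g => conv f g).
Proof. exact: (@conv_bilinear k H).2. Qed.
Lemma linear_lhitl (f : dual H) : linear (fun h => h ⇀ f).
Proof. exact: (@lhit_bilinear k H).1. Qed.
Lemma linear_lhitr (h : H) : linear (fun f => h ⇀ f).
Proof. exact: (@lhit_bilinear k H).2. Qed.
Lemma linear_rhitl (h : H) : linear (fun f => f ↼ h).
Proof. exact: (@rhit_bilinear k H).1. Qed.
Lemma linear_rhitr (f : dual H) : linear (fun h => f ↼ h).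
Proof. exact: (@rhit_bilinear k H).2. Qed.

End Linearity.

(** Proves linearity in one variable by peeling off the outermost operation, whose other arguments
    must be free of the variable. The fallback [eauto] takes the linearity of abstract maps from the
    context. *)
Ltac lin :=
  cbv beta;
  lazymatch goal with
  | |- GRing.linear_for _ (fun x => x) => exact: linear_id_fun
  | |- GRing.linear_for _ (fun x => tsum (@?t x) (@?f x)) =>
      lazymatch f with
      | fun _ => ?c => refine (linear_comp_fun (g := t) (linear_tsum c) _)
      | _ => apply: tsum_linear_param => ? ?
      end; lin
  | |- GRing.linear_for _ (fun x => @?g x \ox @?c x) =>
      lazymatch c with
      | fun _ => ?d => refine (linear_comp_fun (g := g) (linear_tpurel d) _)
      | _ => lazymatch g with fun _ => ?d =>
          refine (linear_comp_fun (g := c) (linear_tpurer d) _) end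
      end; lin
  | |- GRing.linear_for _ (fun x => @?g x * @?c x) =>
      lazymatch c with
      | fun _ => ?d => refine (linear_comp_fun (g := g) (linear_mull d) _)
      | _ => lazymatch g with fun _ => ?d =>
          refine (linear_comp_fun (g := c) (linear_mulr d) _) end
      end; lin
  | |- GRing.linear_for _ (fun x => @?g x *: @?c x) =>
      lazymatch c with
      | fun _ => ?d => refine (linear_comp_fun (g := g) (linear_scalel d) _)
      | _ => lazymatch g with fun _ => ?d =>
          refine (linear_comp_fun (g := c) (linear_scaler d) _) end
      end; lin
  | |- GRing.linear_for _ (fun x => conv (@?g x) (@?c x)) =>
      lazymatch c with
      | fun _ => ?d => refine (linear_comp_fun (g := g) (linear_convl d) _)
      | _ => lazymatch g with fun _ => ?d =>
          refine (linear_comp_fun (g := c) (linear_convr d) _) end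
      end; lin
  | |- GRing.linear_for _ (fun x => lhit (@?g x) (@?c x)) =>
      lazymatch c with
      | fun _ => ?d => refine (linear_comp_fun (g := g) (linear_lhitl d) _)
      | _ => lazymatch g with fun _ => ?d =>
          refine (linear_comp_fun (g := c) (linear_lhitr d) _) end
      end; lin
  | |- GRing.linear_for _ (fun x => rhit (@?g x) (@?c x)) =>
      lazymatch c with
      | fun _ => ?d => refine (linear_comp_fun (g := g) (linear_rhitl d) _)
      | _ => lazymatch g with fun _ => ?d =>
          refine (linear_comp_fun (g := c) (linear_rhitr d) _) end
      end; lin
  | |- GRing.linear_for _ (fun x => fun_of_lfun (@?g x) (@?c x)) =>
      lazymatch c with
      | fun _ => ?d => refine (linear_comp_fun (g := g) (linear_lfunl d) _)
      | _ => lazymatch g with fun _ => ?d =>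
          refine (linear_comp_fun (g := c) (linear_lfunr d) _) end
      end; lin
  | |- GRing.linear_for _ (fun x => GRing.LRMorphism.sort ?f (@?g x)) =>
      refine (linear_comp_fun (g := g) (linearP f) _); lin
  | |- GRing.linear_for _ (fun x => comul3 (@?g x)) =>
      refine (linear_comp_fun (g := g) (@comul3_is_linear _ _) _); lin
  | |- GRing.linear_for _ (fun x => GRing.Linear.sort ?f (@?g x)) =>
      refine (linear_comp_fun (g := g) (linearP f) _); lin
  | |- GRing.linear_for _ (fun _ => _) =>
      first
        [ solve [eauto]
        | lazymatch goal with
          | |- GRing.linear_for _ (fun x => ?F (@?a x) (@?b x) (@?c x)) =>
              lazymatch constr:((a, b, c)) with
              | (_, fun _ => ?v, fun _ => ?w) =>
                  refine (linear_comp_fun (f := fun u => F u v w) (g := a) _ _)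
              | (fun _ => ?u, _, fun _ => ?w) =>
                  refine (linear_comp_fun (f := fun v => F u v w) (g := b) _ _)
              | (fun _ => ?u, fun _ => ?v, _) =>
                  refine (linear_comp_fun (f := fun w => F u v w) (g := c) _ _)
              end
          end; [solve [eauto] | lin] ]
  | |- GRing.linear_for ?s ?f =>
      first [solve [eauto] | change (GRing.linear_for s (fun x => f x)); lin]
  end.

(** Runs on every goal left by a rewrite: linearity side conditions are closed, the main goal
    stays. *)
Ltac mlin := try solve [intros; lin].

(** * Linear maps, interchange and substitution in Sweedler sums *)

Section SweedlerCalculus.
Variable k : fieldType.
Implicit Types U V W Z : vectType k.

Lemma eq_tsum V W U (t : tens V W) (f g : V -> W -> U) :
  (forall v w, f v w = g v w) -> tsum t f = tsum t g.
Proof. by move=> fg; apply: eq_bigr => i _; apply: eq_bigr => j _; rewrite fg. Qed.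

Lemma linear_tsumE V W U Z (t : tens V W) (f : V -> W -> U) (L : U -> Z) :
  linear L -> L (tsum t f) = \sw_(a, b <- t) L (f a b).
Proof.
move=> Ll; pose L' : {linear U -> Z} := HB.pack L (GRing.isLinear.Build k _ _ _ L Ll).
rewrite -[L]/(L' : _ -> _) linear_sum; apply: eq_bigr => i _.
by rewrite linear_sum; apply: eq_bigr => j _; rewrite linearZ.
Qed.

Lemma linear_scaleE U Z (L : U -> Z) c u : linear L -> L (c *: u) = c *: L u.
Proof.
move=> Ll; pose L' : {linear U -> Z} := HB.pack L (GRing.isLinear.Build k _ _ _ L Ll).
by rewrite -[L]/(L' : _ -> _) linearZ.
Qed.

Lemma scaler_tsum V W U (t : tens V W) (f : V -> W -> U) c :
  c *: tsum t f = \sw_(a, b <- t) (c *: f a b).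
Proof. exact: (linear_tsumE _ _ (linear_scaler c)). Qed.

Lemma tsum0 V W U (f : V -> W -> U) : tsum 0 f = 0.
Proof. exact: (linear0 (tlift f)). Qed.

Lemma tsum_eq0 V W U (t : tens V W) (f : V -> W -> U) :
  (forall v w, f v w = 0) -> tsum t f = 0.
Proof. by move=> f0; do 2!apply: big1 => ? _; rewrite f0 scaler0. Qed.

Lemma tsum_tsum V W V' W' U (t : tens V W) (g : V -> W -> tens V' W')
    (f : V' -> W' -> U) :
  tsum (tsum t g) f = \sw_(a, b <- t) \sw_(c, d <- g a b) f c d.
Proof. exact: (linear_tsumE _ _ (linear_tsum f)). Qed.

Lemma lfun_tsumE V W U Z (t : tens V W) (f : V -> W -> 'Hom(U, Z)) u :
  (tsum t f) u = \sw_(a, b <- t) f a b u.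
Proof. exact: (linear_tsumE t f (linear_lfunl u)). Qed.

Lemma tsum_pure V W U (f : V -> W -> U) v w :
    (forall b, linear (fun a => f a b)) -> (forall a, linear (f a)) ->
  \sw_(a, b <- v \ox w) f a b = f v w.
Proof. by move=> fl fr; apply: tsumE. Qed.

(** Each Sweedler sum is a finite double sum over basis indices, so the four sums can be
    interchanged and the coefficients commute. *)
Lemma exchange_tsum V W V' W' U (s : tens V W) (t : tens V' W')
    (f : V -> W -> V' -> W' -> U) :
  \sw_(a, b <- s) \sw_(c, d <- t) f a b c d =
  \sw_(c, d <- t) \sw_(a, b <- s) f a b c d.
Proof.
pose g i j i' j' := f (r2v (delta_mx 0 i)) (r2v (delta_mx 0 j))
  (r2v (delta_mx 0 i')) (r2v (delta_mx 0 j')).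
rewrite /tsum /tlift.
under eq_bigr => i _ do under eq_bigr => j _ do rewrite scaler_sumr.
under [RHS]eq_bigr => i _ do under eq_bigr => j _ do rewrite scaler_sumr.
under eq_bigr => i _ do rewrite exchange_big /=.
rewrite exchange_big /=; apply: eq_bigr => i _.
under eq_bigr => i' _ do under eq_bigr => j' _ do rewrite scaler_sumr.
under eq_bigr => i' _ do rewrite exchange_big /=.
rewrite exchange_big /=; apply: eq_bigr => j _.
apply: eq_bigr => i' _; rewrite scaler_sumr; apply: eq_bigr => j' _.
by rewrite !scalerA mulrC.
Qed.

Lemma exchange_tsum3 V W Z V' W' Z' U (s : tens V (tens W Z)) (t : tens V' (tens W' Z'))
    (f : V -> W -> Z -> V' -> W' -> Z' -> U) :
  \sw_(a, b, c <- s) \sw_(a', b', c' <- t) f a b c a' b' c' =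
  \sw_(a', b', c' <- t) \sw_(a, b, c <- s) f a b c a' b' c'.
Proof.
under eq_tsum => a bc do rewrite exchange_tsum.
rewrite exchange_tsum; apply: eq_tsum => a' bc'.
under eq_tsum => a bc do rewrite exchange_tsum.
by rewrite exchange_tsum.
Qed.

Lemma tsum_pure3 V W Z U (F : V -> W -> Z -> U) v w z :
    (forall b c, linear (fun a => F a b c)) ->
    (forall a c, linear (fun b => F a b c)) -> (forall a b, linear (F a b)) ->
  \sw_(a, b, c <- v \ox w \ox z) F a b c = F v w z.
Proof.
move=> F1 F2 F3; rewrite tsum_pure; first by apply: tsum_pure.
  by move=> b; lin.
move=> a; lin.
Qed.

Lemma tsum_tensM (A B : falgType k) (U : vectType k) (F : A -> B -> U)
    (s t : tens A B) :
    (forall b, linear (fun a => F a b)) -> (forall a, linear (F a)) ->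
  \sw_(a, b <- s * t) F a b =
  \sw_(a, b <- s) \sw_(a', b' <- t) F (a * a') (b * b').
Proof.
move=> F1 F2; rewrite -[s * t]/(tens_mul _ _) tsum_tsum.
by apply: eq_tsum => a b; rewrite tsum_tsum; apply: eq_tsum => c d; rewrite tsum_pure.
Qed.

Lemma eq_on_pure (V W U : vectType k) (f g : 'Hom(tens V W, U)) :
  (forall v w, f (v \ox w) = g (v \ox w)) -> f =1 g.
Proof.
by move=> fg; elim/tens_ind=> // a s t IHs IHt; rewrite !linear_lfunr IHs IHt.
Qed.

End SweedlerCalculus.

(** * The Hopf axioms under Sweedler sums, and the antipode as an anti-morphism *)

Section HopfCalculus.
Variables (k : fieldType) (H : finHopfAlgType k).
Implicit Types (U : vectType k) (h x y : H).

(** [comulA] is an equality of tensors; the linear map induced by the trilinear [F], applied to both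
    sides, turns it into a rewriting rule. *)
Lemma tsum_comulA U (F : H -> H -> H -> U) h :
    (forall b c, linear (fun a => F a b c)) ->
    (forall a c, linear (fun b => F a b c)) -> (forall a b, linear (F a b)) ->
  \sw_(a, b <- comul h) \sw_(c, d <- comul b) F a c d =
  \sw_(a, b <- comul h) \sw_(c, d <- comul a) F c d b.
Proof.
move=> F1 F2 F3.
have /(congr1 (fun t => \sw_(a, b, c <- t) F a b c)) := comulA h.
rewrite !tsum_tsum.
under eq_tsum => a b do [rewrite tsum_tsum;
  under eq_tsum => c d do rewrite tsum_pure3 //].
move->; apply: eq_tsum => a b; rewrite tsum_tsum; apply: eq_tsum => c d.
exact: tsum_pure3.
Qed.

Lemma tsum_comul3 U (F : H -> H -> H -> U) h :
    (forall b c, linear (fun a => F a b c)) ->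
    (forall a c, linear (fun b => F a b c)) -> (forall a b, linear (F a b)) ->
  \sw_(a, b, c <- comul3 h) F a b c =
  \sw_(a, b <- comul h) \sw_(c, d <- comul b) F a c d.
Proof.
move=> F1 F2 F3; rewrite tsum_tsum; apply: eq_tsum => a b.
by rewrite tsum_tsum; apply: eq_tsum => c d; rewrite tsum_pure3.
Qed.

Lemma tsum_comulM U (F : H -> H -> U) x y :
    (forall b, linear (fun a => F a b)) -> (forall a, linear (F a)) ->
  \sw_(a, b <- comul (x * y)) F a b =
  \sw_(a, b <- comul x) \sw_(c, d <- comul y) F (a * c) (b * d).
Proof.
by move=> F1 F2; rewrite rmorphM tsum_tensM.
Qed.

Lemma tsum_comul1 U (F : H -> H -> U) :
    (forall b, linear (fun a => F a b)) -> (forall a, linear (F a)) ->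
  \sw_(a, b <- comul 1) F a b = F 1 1.
Proof. by move=> F1 F2; rewrite rmorph1 -[1]/(tens_one _ _) tsum_pure. Qed.

Lemma tsum_counitl U (F : H -> U) h : linear F ->
  \sw_(a, b <- comul h) (counit a *: F b) = F h.
Proof.
move=> Fl; rewrite -[in RHS](counitl h) (linear_tsumE _ _ Fl).
by apply: eq_tsum => a b; rewrite linear_scaleE.
Qed.

Lemma tsum_counitr U (F : H -> U) h : linear F ->
  \sw_(a, b <- comul h) (counit b *: F a) = F h.
Proof.
move=> Fl; rewrite -[in RHS](counitr h) (linear_tsumE _ _ Fl).
by apply: eq_tsum => a b; rewrite linear_scaleE.
Qed.

Lemma tsum_antipodel U (F : H -> U) h : linear F ->
  \sw_(a, b <- comul h) F (antipode a * b) = counit h *: F 1.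
Proof. by move=> Fl; rewrite -linear_scaleE // -antipodel (linear_tsumE _ _ Fl). Qed.

Lemma tsum_antipoder U (F : H -> U) h : linear F ->
  \sw_(a, b <- comul h) F (a * antipode b) = counit h *: F 1.
Proof. by move=> Fl; rewrite -linear_scaleE // -antipoder (linear_tsumE _ _ Fl). Qed.

(** S(y)S(x) and S(xy) are a left and a right convolution inverse of the multiplication H \ox H ->
    H, so they agree. *)
Lemma antipodeM x y : antipode (x * y) = antipode y * antipode x.
Proof.
(* This is S(y_1)S(x_1)x_2y_2S(x_3y_3). Here the first four factors collapse to counits. *)
transitivity (\sw_(x1, x2 <- comul x) \sw_(x11, x12 <- comul x1)
    \sw_(y1, y2 <- comul y) \sw_(y11, y12 <- comul y1)
      (antipode y11 * antipode x11 * (x12 * y12 * antipode (x2 * y2)))).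
  rewrite -[in LHS](tsum_counitl (F := fun x => antipode (x * y))); mlin.
  apply: eq_tsum => x1 x2; rewrite exchange_tsum.
  rewrite -(tsum_counitl (F := fun y => counit x1 *: antipode (x2 * y))); mlin.
  apply: eq_tsum => y1 y2; rewrite exchange_tsum scalerA mulrC -scalerA.
  transitivity (\sw_(y11, y12 <- comul y1)
     (counit x1 *: (antipode y11 * y12 * antipode (x2 * y2)))).
    rewrite -scaler_tsum; congr (_ *: _).
    by rewrite (tsum_antipodel (F := fun v => v * _)) ?mul1r; mlin.
  apply: eq_tsum => y11 y12.
  rewrite -[antipode y11 in LHS]mulr1 -!mulrA.
  rewrite -(tsum_antipodel (F := fun v => antipode y11 * (v * _))); mlin.
  by apply: eq_tsum => x11 x12; rewrite !mulrA.
(* Coassociativity moves the brackets, so that x_2y_2S(x_3y_3) collapses instead. *)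
rewrite -tsum_comulA; mlin.
transitivity (\sw_(x1, x2 <- comul x) \sw_(y1, y2 <- comul y)
    \sw_(x21, x22 <- comul x2) \sw_(y21, y22 <- comul y2)
      (antipode y1 * antipode x1 * (x21 * y21 * antipode (x22 * y22)))).
  apply: eq_tsum => x1 x2; rewrite [RHS]exchange_tsum; apply: eq_tsum => x21 x22.
  by rewrite -tsum_comulA; mlin.
rewrite -[RHS](tsum_counitr (F := fun x => _ * antipode x)) //; mlin.
apply: eq_tsum => x1 x2.
rewrite -(tsum_counitr (F := fun y => counit x2 *: (antipode y * _))) //; mlin.
apply: eq_tsum => y1 y2.
rewrite -[antipode y1 * _ in RHS]mulr1 scalerA mulrC -rmorphM.
rewrite -(tsum_antipoder (F := fun v => antipode y1 * antipode x1 * v)); mlin.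
by rewrite tsum_comulM; mlin.
Qed.

Lemma antipode1 : antipode (1 : H) = 1.
Proof.
have := antipodel (1 : H); rewrite (tsum_comul1 (F := fun a b => antipode a * b)); mlin.
by rewrite mulr1 rmorph1 scale1r.
Qed.

(** Apply ε to S(h_1)h_2 = ε(h)1 and absorb ε(h_2) by the counit axiom. *)
Lemma counit_antipode h : counit (antipode h) = counit h.
Proof.
rewrite -[in RHS](mulr1 (counit h)) -(rmorph1 (counit (H := H))).
rewrite -[_ * _]/(counit h *: (counit (1 : H) : k^o)).
rewrite -(tsum_antipodel (F := fun v => counit v : k^o)); mlin.
rewrite -[in LHS](tsum_counitr (F := fun x => counit (antipode x) : k^o)); mlin.
by apply: eq_tsum => a b; rewrite rmorphM mulrC.
Qed.

Lemma tens_purM (a b c d : H) : (a \ox b) * (c \ox d) = (a * c) \ox (b * d).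
Proof. exact: tens_mulE. Qed.

(** Uniqueness of convolution inverses again, now in Hom(H, H \ox H): [G] is a left inverse of Δ,
    and Δ after S is a right inverse. *)
Lemma comul_antipode h :
  comul (antipode h) = \sw_(a, b <- comul h) antipode b \ox antipode a.
Proof.
pose G x : tens H H := \sw_(a, b <- comul x) antipode b \ox antipode a.
have Gl : linear G by rewrite /G; lin.
(* In S(x_2)x_3 \ox S(x_1)x_4 the inner pair collapses first, which makes x_1 and x_4 adjacent. *)
have GD x : \sw_(x1, x2 <- comul x) (G x1 * comul x2) = counit x *: 1.
  transitivity (\sw_(x1, x2 <- comul x) \sw_(a, b <- comul x1) \sw_(c, d <- comul x2)
    (antipode b * c) \ox (antipode a * d)).
    apply: eq_tsum => x1 x2; rewrite (linear_tsumE _ _ (linear_mull (comul x2))).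
    apply: eq_tsum => a b; rewrite -{1}[comul x2]tsum_tpure.
    rewrite (linear_tsumE _ _ (linear_mulr (antipode b \ox antipode a))).
    by apply: eq_tsum => c d; rewrite tens_purM.
  rewrite -tsum_comulA; mlin.
  have -> : counit x *: (1 : tens H H) = counit x *: (1 \ox 1) by [].
  rewrite -(tsum_antipodel (F := fun v => 1 \ox v)); mlin.
  apply: eq_tsum => a x'; rewrite tsum_comulA; mlin.
  rewrite -[in RHS](tsum_counitl (F := fun x => 1 \ox (antipode a * x))); mlin.
  apply: eq_tsum => y d.
  by rewrite (tsum_antipodel (F := fun v => v \ox (antipode a * d))); mlin.
rewrite -[antipode h in LHS](tsum_counitl (F := fun x => antipode x)); mlin.
rewrite (linear_tsumE _ _ (linearP comul)).
(* G(h_1)Δ(h_2)Δ(S(h_3)) is evaluated in both bracketings. *)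
transitivity (\sw_(x1, x2 <- comul h) \sw_(x11, x12 <- comul x1)
    (G x11 * comul x12 * comul (antipode x2))).
  apply: eq_tsum => x1 x2; rewrite -(linear_tsumE _ _ (linear_mull (comul (antipode x2)))).
  by rewrite GD -scalerAl mul1r linearZ.
rewrite -tsum_comulA; mlin.
rewrite -[RHS](tsum_counitr (F := G)) //.
apply: eq_tsum => x1 x2.
transitivity (\sw_(x21, x22 <- comul x2) (G x1 * comul (x21 * antipode x22))).
  by apply: eq_tsum => x21 x22; rewrite rmorphM mulrA.
by rewrite (tsum_antipoder (F := fun v => G x1 * comul v)); mlin; rewrite rmorph1 mulr1.
Qed.

Lemma tsum_comul_antipode U (F : H -> H -> U) h :
    (forall b, linear (fun a => F a b)) -> (forall a, linear (F a)) ->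
  \sw_(a, b <- comul (antipode h)) F a b =
  \sw_(a, b <- comul h) F (antipode b) (antipode a).
Proof.
move=> F1 F2; rewrite comul_antipode tsum_tsum.
by apply: eq_tsum => a b; rewrite tsum_pure.
Qed.

End HopfCalculus.

(** * Bijectivity of the antipode *)

Section DualTensor.
Variables (k : fieldType) (V W : vectType k).

(** Extensionality for tensors with a dual leg: expanded along the basis of W, a tensor has
    coefficients in V^*, and these are read off from the values of the induced map. *)
Lemma tens_dual_inj (s t : tens (dual V) W) :
    (forall x, \sw_(f, w <- s) ((f : dual V) x *: w) =
               \sw_(f, w <- t) ((f : dual V) x *: w)) ->
  s = t.
Proof.
(* [g u j] is the functional that multiplies the j-th basis vector of W in [u]. *)
pose g (u : tens (dual V) W) j : dual V :=
  \sum_i (u : 'M_(_, _)) i j *: r2v (delta_mx 0 i).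
have gE u x : \sw_(f, w <- u) ((f : dual V) x *: w) = r2v (\row_j (g u j x : k)).
  rewrite [\row_j _]row_sum_delta linear_sum [LHS]exchange_big /=.
  apply: eq_bigr => j _; rewrite linearZ /= mxE /g sum_lfunE scaler_suml.
  by apply: eq_bigr => i _; rewrite scale_lfunE scalerA.
move=> st; apply/matrixP => i j.
have: g s j = g t j.
  by apply/lfunP => x; have := st x; rewrite !gE => /(can_inj r2vK)/rowP/(_ j); rewrite !mxE.
move/(congr1 (fun f => v2r f 0 i)).
have gi u : v2r (g u j) 0 i = (u : 'M_(_, _)) i j.
  rewrite linear_sum summxE (bigD1 i) //= big1 => [|i' ne].
    by rewrite linearZ /= r2vK !mxE !eqxx mulr1 addr0.
  by rewrite linearZ /= r2vK !mxE eq_sym (negPf ne) andbF mulr0.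
by rewrite !gi.
Qed.

(** The preimage is the sum of the coordinate functionals of [T] tensored with the basis of W. *)
Lemma tens_dual_surj (T : V -> W) : linear T ->
  exists s : tens (dual V) W, forall x, \sw_(f, w <- s) ((f : dual V) x *: w) = T x.
Proof.
move=> Tl; pose c j : dual V := linfun (fun x => v2r (T x) 0 j : k^o).
exists (\sum_j (c j \ox r2v (delta_mx 0 j))) => x.
have -> : T x = r2v (v2r (T x)) by rewrite v2rK.
rewrite [v2r _]row_sum_delta linear_sum /tsum raddf_sum; apply: eq_bigr => j _.
rewrite [LHS](tsum_pure (f := fun (f : dual V) w => f x *: w)); mlin.
rewrite /c linfunE ?linearZ //= => a u v.
by rewrite Tl linearP !mxE.
Qed.

End DualTensor.

(** * H^* as a Hopf module, its coinvariants, and injectivity of the antipode *)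

Section AntipodeBijective.
Variables (k : fieldType) (H : finHopfAlgType k).
Implicit Types (f phi : dual H) (h x : H).

Lemma lhitM h h' f : h ⇀ h' ⇀ f = (h * h') ⇀ f.
Proof. by apply/lfunP => x; rewrite !lhitE mulrA. Qed.

(** The identification of H^* \ox H with End(H), through which the coaction is defined. *)
Let ev : 'Hom(tens (dual H) H, 'Hom(H, H)) :=
  linfun (fun s => linfun (fun x => \sw_(f, h <- s) ((f : dual H) x *: h))).

Let evE s x : ev s x = \sw_(f, h <- s) ((f : dual H) x *: h).
Proof.
have lin1 (t : tens (dual H) H) : linear (fun x => \sw_(f, h <- t) ((f : dual H) x *: h)).
  by lin.
rewrite linfunE ?linfunE // => a u v; apply/lfunP => y.
by rewrite add_lfunE scale_lfunE !linfunE //; apply: linear_tsum.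
Qed.

(** The standard left action of H^* on H. *)
Let hitl phi : 'Hom(H, H) := linfun (fun x => \sw_(a, b <- comul x) (phi b *: a)).

Let hitlE phi x : hitl phi x = \sw_(a, b <- comul x) (phi b *: a).
Proof. by rewrite linfunE; mlin. Qed.

Let hitl_linear : linear hitl.
Proof.
move=> a f g; apply/lfunP => x; rewrite add_lfunE scale_lfunE !hitlE.
have L : linear (fun f : dual H => \sw_(p, q <- comul x) (f q *: p)) by lin.
exact: L.
Qed.

(* The right H-coaction on H^* dual to the left multiplication of H^* on itself. *)
Definition dual_coaction : 'Hom(dual H, tens (dual H) H) := (ev^-1 \o linfun hitl)%VF.

Lemma dual_coactionE phi x :
  \sw_(f, h <- dual_coaction phi) ((f : dual H) x *: h) =
  \sw_(a, b <- comul x) (phi b *: a).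
Proof.
have Tl : linear (fun x => \sw_(a, b <- comul x) (phi b *: a)) by lin.
rewrite -evE /dual_coaction comp_lfunE [linfun hitl _]linfunE // -hitlE limg_lfunVK //.
(* The pseudo-inverse is a section of [ev] over its image; [tens_dual_surj] puts [hitl phi] in that
   image. *)
have [s sE] := tens_dual_surj Tl.
have -> : hitl phi = ev s by apply/lfunP => y; rewrite evE hitlE sE.
by apply: memv_img; apply: memvf.
Qed.

(** Coassociativity of the coaction. Evaluating the H^* leg at x turns both sides into phi(x_3) x_1
    \ox x_2, so it comes from coassociativity of H. *)
Lemma dual_coactionA (U : vectType k) (F : dual H -> H -> H -> U) phi :
    (forall b c, linear (fun a => F a b c)) ->
    (forall a c, linear (fun b => F a b c)) -> (forall a b, linear (F a b)) ->
  \sw_(f0, f1 <- dual_coaction phi) \sw_(g0, g1 <- dual_coaction f0) F g0 g1 f1 =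
  \sw_(f0, f1 <- dual_coaction phi) \sw_(a, b <- comul f1) F f0 a b.
Proof.
move=> F1 F2 F3.
(* It suffices to treat the universal trilinear map. *)
suff /(congr1 (fun t => \sw_(a, b, c <- t) F a b c)) :
    \sw_(f0, f1 <- dual_coaction phi) \sw_(g0, g1 <- dual_coaction f0) (g0 \ox g1 \ox f1) =
    \sw_(f0, f1 <- dual_coaction phi) \sw_(a, b <- comul f1) (f0 \ox a \ox b).
  rewrite !tsum_tsum.
  under eq_tsum => a b do [rewrite tsum_tsum;
    under eq_tsum => c d do rewrite tsum_pure3 //].
  move->; apply: eq_tsum => a b; rewrite tsum_tsum; apply: eq_tsum => c d.
  exact: tsum_pure3.
apply: tens_dual_inj => x; rewrite !tsum_tsum.
transitivity (\sw_(f0, f1 <- dual_coaction phi) \sw_(a, b <- comul x)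
    (f0 b *: (a \ox f1))).
  apply: eq_tsum => f0 f1; rewrite tsum_tsum.
  transitivity (\sw_(g0, g1 <- dual_coaction f0) ((g0 : dual H) x *: (g1 \ox f1))).
    apply: eq_tsum => g0 g1.
    by apply: (tsum_pure (f := fun (f : dual H) w => f x *: w)); mlin.
  transitivity ((\sw_(g0, g1 <- dual_coaction f0) ((g0 : dual H) x *: g1)) \ox f1).
    rewrite (linear_tsumE _ _ (linear_tpurel f1)); apply: eq_tsum => g0 g1.
    by rewrite (linear_scaleE _ _ (linear_tpurel f1)).
  rewrite dual_coactionE (linear_tsumE _ _ (linear_tpurel f1)).
  by apply: eq_tsum => a b; rewrite (linear_scaleE _ _ (linear_tpurel f1)).
rewrite exchange_tsum.
transitivity (\sw_(a, b <- comul x) \sw_(c, d <- comul a) (phi b *: (c \ox d))).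
  rewrite -tsum_comulA; mlin; apply: eq_tsum => a b.
  transitivity (a \ox (\sw_(f0, f1 <- dual_coaction phi) ((f0 : dual H) b *: f1))).
    rewrite (linear_tsumE _ _ (linear_tpurer a)); apply: eq_tsum => f0 f1.
    by rewrite (linear_scaleE _ _ (linear_tpurer a)).
  rewrite dual_coactionE (linear_tsumE _ _ (linear_tpurer a)).
  by apply: eq_tsum => c d; rewrite (linear_scaleE _ _ (linear_tpurer a)).
(* For the other side, Δ is applied to phi(x_2) x_1. *)
transitivity (comul (\sw_(f0, f1 <- dual_coaction phi) ((f0 : dual H) x *: f1))).
  rewrite dual_coactionE (linear_tsumE _ _ (linearP comul)); apply: eq_tsum => a b.
  by rewrite linearZ /= -[in RHS](tsum_tpure (comul a)) scaler_tsum.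
rewrite (linear_tsumE _ _ (linearP comul)); apply: eq_tsum => f0 f1.
rewrite linearZ /= -[in LHS](tsum_tpure (comul f1)) scaler_tsum tsum_tsum.
apply: eq_tsum => a b.
by symmetry; apply: (tsum_pure (f := fun (f : dual H) w => f x *: w)); mlin.
Qed.

(* (phi, h) |-> S h ⇀ phi is the action that makes H^* a Hopf module. *)
Lemma hit_antipode_comul phi h x :
  \sw_(a, b <- comul x) ((antipode h ⇀ phi) b *: a) =
  \sw_(h1, h2 <- comul h) \sw_(a, b <- comul (x * antipode h1)) (phi b *: (a * h2)).
Proof.
(* A factor S(h_2)h_3 is inserted; S(h_1) and S(h_2) then recombine into the comultiplication of an
   antipode. *)
transitivity (\sw_(a, b <- comul x) \sw_(h1, h2 <- comul h) \sw_(c, d <- comul h1)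
   (phi (b * antipode c) *: (a * (antipode d * h2)))).
  apply: eq_tsum => a b; rewrite -tsum_comulA; mlin; rewrite lhitE.
  rewrite -[in LHS](tsum_counitr (F := fun h => phi (b * antipode h) *: a)); mlin.
  apply: eq_tsum => c h'.
  rewrite (tsum_antipodel (F := fun v => phi (b * antipode c) *: (a * v))) ?mulr1 //; mlin.
rewrite exchange_tsum; apply: eq_tsum => h1 h2.
rewrite tsum_comulM; mlin; apply: eq_tsum => a b.
rewrite tsum_comul_antipode; mlin; apply: eq_tsum => c d.
by rewrite mulrA.
Qed.

(** The condition that the coaction sends [lam] to lam \ox 1, evaluated on the H^* leg;
    equivalently, [lam] is a left integral of H^*. *)
Definition coinvariant (lam : dual H) : Prop :=
  forall x, \sw_(a, b <- comul x) (lam b *: a) = lam x *: 1.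

(** The Hopf module projection m |-> m_0 . S(m_1) onto the coinvariants. As h acts through S(h), the
    antipode occurs twice. *)
Definition coinvariant_part (phi : dual H) : dual H :=
  \sw_(f0, f1 <- dual_coaction phi) (antipode (antipode f1) ⇀ f0).

(** By the Hopf module law the coaction sends m_0 . S(m_1) to m_0 . S(m_3) \ox m_1S(m_2), where
    m_1S(m_2) cancels. *)
Lemma coinvariant_partP phi : coinvariant (coinvariant_part phi).
Proof.
move=> x; rewrite /coinvariant_part.
transitivity (\sw_(f0, f1 <- dual_coaction phi) \sw_(a, b <- comul x)
    ((antipode (antipode f1) ⇀ f0) b *: a)).
  rewrite exchange_tsum; apply: eq_tsum => a b.
  rewrite lfun_tsumE.
  by rewrite (linear_tsumE _ _ (linear_scalel a)).
transitivity (\sw_(f0, f1 <- dual_coaction phi) \sw_(c, d <- comul f1)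
    \sw_(g0, g1 <- dual_coaction f0)
      ((g0 : dual H) (x * antipode (antipode d)) *: (g1 * antipode c))).
  apply: eq_tsum => f0 f1; rewrite hit_antipode_comul tsum_comul_antipode; mlin.
  apply: eq_tsum => c d.
  transitivity ((\sw_(a, b <- comul (x * antipode (antipode d))) (f0 b *: a)) * antipode c).
    rewrite (linear_tsumE _ _ (linear_mull _)); apply: eq_tsum => a b.
    by rewrite scalerAl.
  rewrite -dual_coactionE (linear_tsumE _ _ (linear_mull _)).
  by apply: eq_tsum => a b; rewrite scalerAl.
under eq_tsum => f0 f1 do rewrite exchange_tsum.
rewrite (dual_coactionA (F := fun (g0 : dual H) (g1 f1 : H) => \sw_(c, d <- comul f1)
  (g0 (x * antipode (antipode d)) *: (g1 * antipode c)))); mlin.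
rewrite lfun_tsumE (linear_tsumE _ _ (linear_scalel 1)).
apply: eq_tsum => f0 f1; rewrite tsum_comulA; mlin; rewrite lhitE.
rewrite -[in RHS](tsum_counitl (F := fun d => f0 (x * antipode (antipode d)) *: 1)); mlin.
apply: eq_tsum => y d.
by rewrite -scaler_tsum antipoder !scalerA mulrC.
Qed.

(** The coinvariants generate H^*: the left side is m_0 . S(m_1)m_2. *)
Lemma coinvariant_decomposition phi :
  \sw_(f0, f1 <- dual_coaction phi) (antipode f1 ⇀ coinvariant_part f0) = phi.
Proof.
rewrite /coinvariant_part.
transitivity (\sw_(f0, f1 <- dual_coaction phi) \sw_(g0, g1 <- dual_coaction f0)
    (antipode (antipode g1 * f1) ⇀ g0)).
  apply: eq_tsum => f0 f1; rewrite (linear_tsumE _ _ (linear_lhitr _)).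
  by apply: eq_tsum => g0 g1; rewrite lhitM antipodeM.
rewrite (dual_coactionA (F := fun (g0 : dual H) (g1 f1 : H) =>
  antipode (antipode g1 * f1) ⇀ g0)); mlin.
apply/lfunP => x; rewrite lfun_tsumE.
(* Once S(m_1)m_2 collapses, the counit axiom of the coaction remains; it follows by applying ε to
   [dual_coactionE]. *)
transitivity (counit (\sw_(f0, f1 <- dual_coaction phi) ((f0 : dual H) x *: f1)) : k^o).
  rewrite (linear_tsumE _ _ (linearP counit)); apply: eq_tsum => f0 f1.
  rewrite (tsum_antipodel (F := fun v => antipode v ⇀ f0)); mlin.
  by rewrite antipode1 scale_lfunE lhitE mulr1 linearZ; exact: mulrC.
rewrite dual_coactionE (linear_tsumE _ _ (linearP counit)).
rewrite -[RHS](tsum_counitl (F := fun x => phi x : k^o)); mlin.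
by apply: eq_tsum => a b; rewrite linearZ; exact: mulrC.
Qed.

(** If S(h) = 0 then lam . h = 0, so its coaction lam . h_1 \ox h_2 vanishes; the Galois-type map m
    \ox h |-> m . S(h_1) \ox h_2 recovers lam \ox h from it. *)
Lemma coinvariant_antipode_eq0 lam h x :
  coinvariant lam -> antipode h = 0 -> lam x *: h = 0.
Proof.
move=> lamP h0.
have s0 : \sw_(h1, h2 <- comul h) ((antipode h1 ⇀ lam) \ox h2) = 0 :> tens (dual H) H.
  apply: tens_dual_inj => y; rewrite tsum_tsum tsum0.
  transitivity (\sw_(a, b <- comul y) ((antipode h ⇀ lam) b *: a)).
    rewrite hit_antipode_comul; apply: eq_tsum => h1 h2.
    rewrite (tsum_pure (f := fun (f : dual H) w => f y *: w)); mlin.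
    rewrite lhitE -[in LHS](mul1r h2) scalerAl -lamP (linear_tsumE _ _ (linear_mull h2)).
    by apply: eq_tsum => a b; rewrite scalerAl.
  rewrite h0 (_ : 0 ⇀ lam = 0) => [|]; last exact: linear0l.
  rewrite -dual_coactionE raddf0 tsum0 //.
(* The map m \ox h |-> (m . S(h_1))(x) h_2 is applied to the zero tensor. *)
transitivity (\sw_(f, h <- (0 : tens (dual H) H)) \sw_(a, b <- comul h)
    ((f : dual H) (x * antipode (antipode a)) *: b)); last exact: tsum0.
rewrite -s0 tsum_tsum.
transitivity (\sw_(h1, h2 <- comul h) \sw_(a, b <- comul h2)
    (lam (x * antipode (antipode a) * antipode h1) *: b)); last first.
  apply: eq_tsum => h1 h2; rewrite (tsum_pure (f := fun (f : dual H) h =>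
    \sw_(a, b <- comul h) (f (x * antipode (antipode a)) *: b))); mlin.
  by apply: eq_tsum => a b; rewrite lhitE.
rewrite tsum_comulA; mlin.
rewrite -[in LHS](tsum_counitl (F := fun h => lam x *: h)); mlin.
apply: eq_tsum => h1 h2.
transitivity (\sw_(a, b <- comul h1) (lam (x * antipode (a * antipode b)) *: h2)).
  rewrite (tsum_antipoder (F := fun v => lam (x * antipode v) *: h2)); mlin.
  by rewrite antipode1 mulr1.
by apply: eq_tsum => a b; rewrite antipodeM mulrA.
Qed.

(** A nonzero h with S(h) = 0 would make all coinvariants vanish, hence also ε by the decomposition,
    although ε(1) = 1. *)
Lemma antipode_inj : injective (antipode (H := H)).
Proof.
apply: raddf_inj => h h0; apply/eqP; apply: contraT => h_neq0.
have part0 phi : coinvariant_part phi = 0.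
  apply/lfunP => x; rewrite zero_lfunE; apply/eqP.
  have /eqP := coinvariant_antipode_eq0 x (coinvariant_partP phi) h0.
  by rewrite scaler_eq0 (negPf h_neq0) orbF.
have /lfunP/(_ 1) := coinvariant_decomposition (conv_one H).
rewrite tsum_eq0 => [|f0 f1]; last by rewrite part0 linear0r.
rewrite zero_lfunE linfunE; last exact: linearP.
by rewrite rmorph1 => /eqP; rewrite eq_sym oner_eq0.
Qed.

End AntipodeBijective.

(** * The Drinfeld double *)

Section InverseAntipode.
Variables (k : fieldType) (H : finHopfAlgType k).
Implicit Types (f g : dual H) (x y h : H).
Local Notation S' := (@antipodeV k H).

Lemma antipodeK : cancel (antipode (H := H)) S'.
Proof.
have Sker : lker (linfun (antipode (H := H))) == 0%VS.
  by apply/lker0P => x y; rewrite !linfunE; [apply: antipode_inj | exact: linearP..].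
move=> x; have := lker0_lfunK Sker x.
by rewrite [linfun _ x]linfunE; last exact: linearP.
Qed.

(** An injective endomorphism of a finite dimensional space is onto, so the pseudo-inverse is a
    right inverse too. *)
Lemma antipodeVK : cancel S' (antipode (H := H)).
Proof.
have Sker : lker (linfun (antipode (H := H))) == 0%VS.
  by apply/lker0P => x y; rewrite !linfunE; [apply: antipode_inj | exact: linearP..].
move=> x; have := lker0_lfunVK Sker x.
by rewrite [linfun _ _]linfunE; last exact: linearP.
Qed.

Lemma antipodeVM x y : S' (x * y) = S' y * S' x.
Proof. by apply: (can_inj antipodeK); rewrite antipodeM !antipodeVK. Qed.

Lemma antipodeV1 : S' 1 = 1.
Proof. by apply: (can_inj antipodeK); rewrite antipodeVK antipode1. Qed.

Lemma counit_antipodeV x : counit (S' x) = counit x.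
Proof. by rewrite -[in RHS](antipodeVK x) counit_antipode. Qed.

Lemma tsum_comul_antipodeV (U : vectType k) (F : H -> H -> U) x :
    (forall b, linear (fun a => F a b)) -> (forall a, linear (F a)) ->
  \sw_(a, b <- comul (S' x)) F a b = \sw_(a, b <- comul x) F (S' b) (S' a).
Proof.
move=> F1 F2; rewrite -[in RHS](antipodeVK x) tsum_comul_antipode.
- by apply: eq_tsum => a b; rewrite !antipodeK.
- by move=> b; apply: (linear_comp_fun (f := fun v => F _ v)); mlin.
by move=> b; apply: (linear_comp_fun (f := fun v => F v _)); mlin.
Qed.

Lemma rhitM f x y : f ↼ x ↼ y = f ↼ (x * y).
Proof. by apply/lfunP => z; rewrite !rhitE mulrA. Qed.

Lemma hitA f x y : (x ⇀ f) ↼ y = x ⇀ (f ↼ y).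
Proof. by apply/lfunP => z; rewrite !(rhitE, lhitE) mulrA. Qed.

Lemma lhit1 f : 1 ⇀ f = f.
Proof. by apply/lfunP => z; rewrite lhitE mulr1. Qed.

Lemma rhit1 f : f ↼ 1 = f.
Proof. by apply/lfunP => z; rewrite rhitE mul1r. Qed.

Lemma lhit_conv f g h :
  h ⇀ conv f g = \sw_(h1, h2 <- comul h) conv (h1 ⇀ f) (h2 ⇀ g).
Proof.
apply/lfunP => x; rewrite lhitE convE lfun_tsumE tsum_comulM; mlin.
rewrite exchange_tsum; apply: eq_tsum => h1 h2; rewrite convE.
by apply: eq_tsum => a b; rewrite !lhitE.
Qed.

Lemma rhit_conv f g h :
  conv f g ↼ h = \sw_(h1, h2 <- comul h) conv (f ↼ h1) (g ↼ h2).
Proof.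
apply/lfunP => x; rewrite rhitE convE lfun_tsumE tsum_comulM; mlin.
apply: eq_tsum => h1 h2; rewrite convE.
by apply: eq_tsum => a b; rewrite !rhitE.
Qed.

(** S^-1 reverses the comultiplication, so the first factor receives the second part of y. *)
Lemma hit_conv f g x y :
  x ⇀ conv f g ↼ S' y =
  \sw_(a, a' <- comul x) \sw_(c, c' <- comul y)
    conv (a ⇀ f ↼ S' c') (a' ⇀ g ↼ S' c).
Proof.
rewrite lhit_conv (linear_tsumE _ _ (linear_rhitl _)); apply: eq_tsum => a a'.
by rewrite rhit_conv tsum_comul_antipodeV; mlin.
Qed.

Lemma convA f g (e : dual H) : conv f (conv g e) = conv (conv f g) e.
Proof.
apply/lfunP => x; rewrite !convE.
transitivity (\sw_(a, b <- comul x) \sw_(c, d <- comul b) (f a * (g c * e d)) : k^o).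
  apply: eq_tsum => a b; rewrite convE.
  exact: (linear_tsumE _ _ (linear_mulr (f a))).
rewrite tsum_comulA; mlin; apply: eq_tsum => a b; rewrite convE.
rewrite (linear_tsumE _ _ (linear_mull (e b : k^o))).
by apply: eq_tsum => c d; rewrite mulrA.
Qed.

Lemma conv_oneE x : conv_one H x = counit x.
Proof. by rewrite linfunE //; apply: linearP. Qed.

Lemma conv1f f : conv (conv_one H) f = f.
Proof.
apply/lfunP => x; rewrite convE -[RHS](tsum_counitl (F := f)); mlin.
by apply: eq_tsum => a b; rewrite conv_oneE.
Qed.

Lemma convf1 f : conv f (conv_one H) = f.
Proof.
apply/lfunP => x; rewrite convE -[RHS](tsum_counitr (F := f)); mlin.
by apply: eq_tsum => a b; rewrite conv_oneE; apply: mulrC.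
Qed.

Lemma lhit_conv_one h : h ⇀ conv_one H = counit h *: conv_one H.
Proof.
apply/lfunP => x; rewrite lhitE scale_lfunE !conv_oneE rmorphM; exact: mulrC.
Qed.

Lemma rhit_conv_one h : conv_one H ↼ h = counit h *: conv_one H.
Proof. by apply/lfunP => x; rewrite rhitE scale_lfunE !conv_oneE rmorphM. Qed.

Lemma tsum_comul3M (U : vectType k) (F : H -> H -> H -> U) x y :
    (forall b c, linear (fun a => F a b c)) ->
    (forall a c, linear (fun b => F a b c)) -> (forall a b, linear (F a b)) ->
  \sw_(a, b, c <- comul3 (x * y)) F a b c =
  \sw_(a, b, c <- comul3 x) \sw_(a', b', c' <- comul3 y) F (a * a') (b * b') (c * c').
Proof.
move=> F1 F2 F3; rewrite !tsum_comul3 //; mlin.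
rewrite tsum_comulM; mlin; apply: eq_tsum => x1 x2.
under [RHS]eq_tsum => x21 x22 do [rewrite tsum_comul3; mlin].
rewrite [RHS]exchange_tsum; apply: eq_tsum => y1 y2.
by rewrite tsum_comulM; mlin.
Qed.

(** Both sides run over h_1, ..., h_5: one splits the middle of three parts, the other the two outer
    parts. *)
Lemma tsum_comul3_mid (U : vectType k) (F : H -> H -> H -> H -> H -> U) h :
    (forall b c d e, linear (fun a => F a b c d e)) ->
    (forall a c d e, linear (fun b => F a b c d e)) ->
    (forall a b d e, linear (fun c => F a b c d e)) ->
    (forall a b c e, linear (fun d => F a b c d e)) ->
    (forall a b c d, linear (F a b c d)) ->
  \sw_(a, x, e <- comul3 h) \sw_(b, c, d <- comul3 x) F a b c d e =
  \sw_(x, c, y <- comul3 h) \sw_(a, b <- comul x) \sw_(d, e <- comul y) F a b c d e.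
Proof.
move=> F1 F2 F3 F4 F5; rewrite !tsum_comul3; mlin.
under [RHS]eq_tsum => x z do rewrite exchange_tsum.
rewrite -tsum_comulA; mlin; apply: eq_tsum => a z.
under eq_tsum => x e do [rewrite tsum_comul3; mlin].
rewrite -tsum_comulA; mlin; apply: eq_tsum => b y.
by rewrite -tsum_comulA; mlin.
Qed.

Lemma drinfeld_double_bilinear : bilinear_for *:%R *:%R (amul (drinfeld_double H)).
Proof. by split=> [y|x]; rewrite /= /applyr; lin. Qed.

(** On pure tensors both sides become f (h_1 ⇀ f' ↼ S^-1(h_5)) (h_2h'_1 ⇀ f'' ↼ S^-1(h_4h'_3)) \ox
    h_3h'_2h'', since the two actions distribute over convolution. *)
Lemma drinfeld_double_assoc : associative (amul (drinfeld_double H)).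
Proof.
have DL c (x y z : tens (dual H) H) : amul (drinfeld_double H) (c *: x + y) z =
    c *: amul (drinfeld_double H) x z + amul (drinfeld_double H) y z.
  exact: drinfeld_double_bilinear.1.
have DR c (x y z : tens (dual H) H) : amul (drinfeld_double H) z (c *: x + y) =
    c *: amul (drinfeld_double H) z x + amul (drinfeld_double H) z y.
  exact: drinfeld_double_bilinear.2.
move=> s t u; elim/tens_ind: s => [f h|x s s' IHs IHs']; last first.
  by rewrite !DL IHs IHs'.
elim/tens_ind: t => [f' h'|x t t' IHt IHt']; last first.
  by rewrite !(DL, DR) IHt IHt'.
elim/tens_ind: u => [f'' h''|x u u' IHu IHu']; last by rewrite !DR IHu IHu'.
rewrite !drinfeld_doubleE.
have Ll z : linear (fun w => amul (drinfeld_double H) w z) by move=> ? ? ?; exact: DL.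
have Lr z : linear (amul (drinfeld_double H) z) by move=> ? ? ?; exact: DR.
transitivity (\sw_(x, b, y <- comul3 h) \sw_(a, a' <- comul x) \sw_(c, c' <- comul y)
    \sw_(d1, d2, d3 <- comul3 h')
      conv (conv f (a ⇀ f' ↼ S' c')) ((a' * d1) ⇀ f'' ↼ S' (c * d3)) \ox
        (b * d2 * h'')).
  rewrite (linear_tsumE _ _ (Lr (f \ox h))).
  transitivity (\sw_(d1, d2, d3 <- comul3 h') \sw_(x, b, y <- comul3 h)
      conv f (x ⇀ conv f' (d1 ⇀ f'' ↼ S' d3) ↼ S' y) \ox (b * (d2 * h''))).
    apply: eq_tsum => d1 d'; rewrite (linear_tsumE _ _ (Lr (f \ox h))).
    by apply: eq_tsum => d2 d3; rewrite drinfeld_doubleE.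
  rewrite exchange_tsum3.
  apply: eq_tsum => x z; apply: eq_tsum => b y.
  under [RHS]eq_tsum => a a' do rewrite exchange_tsum.
  rewrite [RHS]exchange_tsum; apply: eq_tsum => d1 d'.
  under [RHS]eq_tsum => a a' do rewrite exchange_tsum.
  rewrite [RHS]exchange_tsum; apply: eq_tsum => d2 d3.
  rewrite hit_conv (linear_tsumE _ _ (linear_convr f)).
  rewrite (linear_tsumE _ _ (linear_tpurel _)); apply: eq_tsum => a a'.
  rewrite (linear_tsumE _ _ (linear_convr f)).
  rewrite (linear_tsumE _ _ (linear_tpurel _)); apply: eq_tsum => c c'.
  by rewrite convA -[a' ⇀ (_ ↼ _)]hitA lhitM rhitM antipodeVM mulrA.
transitivity (\sw_(h1, h2, h3 <- comul3 h)
    amul (drinfeld_double H) (conv f (h1 ⇀ f' ↼ S' h3) \ox (h2 * h')) (f'' \ox h'')).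
  (* The outer product comultiplies the middle part of h once more, giving the other bracketing of
     the five parts. *)
  rewrite -tsum_comul3_mid; mlin; apply: eq_tsum => a z; apply: eq_tsum => x c'.
  by rewrite drinfeld_doubleE tsum_comul3M; mlin.
rewrite (linear_tsumE _ _ (Ll (f'' \ox h''))); apply: eq_tsum => a z.
by rewrite (linear_tsumE _ _ (Ll (f'' \ox h''))).
Qed.

(** The acted-on ε becomes ε(h_1)ε(h_3)ε, so only the H legs multiply. In particular h |-> ε \ox h
    is multiplicative. *)
Lemma drinfeld_doubleMr f h h' :
  amul (drinfeld_double H) (f \ox h) (conv_one H \ox h') = f \ox (h * h').
Proof.
rewrite drinfeld_doubleE tsum_comul3; mlin.
rewrite -[in RHS](tsum_counitr (F := fun h => f \ox (h * h'))); mlin.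
rewrite tsum_comulA; mlin; apply: eq_tsum => a b.
rewrite -[in RHS](tsum_counitl (F := fun a => counit b *: (f \ox (a * h')))); mlin.
apply: eq_tsum => c d; rewrite lhit_conv_one linearZl_LR /= rhit_conv_one.
by rewrite counit_antipodeV !linearZr_LR /= convf1 !linearZl_LR.
Qed.

Lemma drinfeld_double_is_algebra : is_algebra (drinfeld_double H).
Proof.
split; [exact: drinfeld_double_bilinear | exact: drinfeld_double_assoc | |].
  elim/tens_ind=> [f h|x s s' IHs IHs']; last by rewrite drinfeld_double_bilinear.2 IHs IHs'.
  rewrite drinfeld_doubleE tsum_comul3; mlin.
  rewrite tsum_comul1; mlin; rewrite tsum_comul1; mlin.
  by rewrite conv1f lhit1 antipodeV1 rhit1 mul1r.
elim/tens_ind=> [f h|x s s' IHs IHs'].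
  by rewrite drinfeld_doubleMr mulr1.
by rewrite drinfeld_double_bilinear.1 IHs IHs'.
Qed.
End InverseAntipode.

(** * Factorizations and twisted tensor products *)

Section TwistedTensorRecognition.
Variable k : fieldType.

(** The algebra laws hold in [B], and [f] reflects equalities. *)
Lemma is_algebra_inj (V W : vectType k) (A : alg_ops V) (B : alg_ops W)
    (f : 'Hom(V, W)) :
    bilinear_for *:%R *:%R (amul A) -> is_algebra B -> injective f ->
    f (aone A) = aone B -> {morph f : x y / amul A x y >-> amul B x y} ->
  is_algebra A.
Proof.
move=> Abil [_ BA B1l B1r] f_inj f1 fM.
by split=> // [x y z|x|x]; apply: f_inj; rewrite !fM ?BA ?f1 ?B1l ?B1r.
Qed.

Variables (V W D : vectType k) (A : alg_ops V) (B : alg_ops W) (E : alg_ops D).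
Variables (R : 'Hom(tens W V, tens V W)) (m : 'Hom(tens V W, D)).
Variables (j : 'Hom(V, D)) (i : 'Hom(W, D)).
Hypotheses (B1_neq0 : aone B != 0) (B_alg : is_algebra B).
Hypothesis A_bilinear : bilinear_for *:%R *:%R (amul A).
Hypotheses (E_alg : is_algebra E) (m_bij : bijective m).
Hypotheses (j1 : j (aone A) = aone E) (i1 : i (aone B) = aone E).
Hypotheses (jM : {morph j : x y / amul A x y >-> amul E x y}).
Hypotheses (iM : {morph i : x y / amul B x y >-> amul E x y}).
Hypothesis mE : forall a b, m (a \ox b) = amul E (j a) (i b).
Hypothesis mR : forall a b, m (R (b \ox a)) = amul E (i b) (j a).

Let EA : associative (amul E). Proof. by case: E_alg. Qed.
Let E1l : left_id (aone E) (amul E). Proof. by case: E_alg. Qed.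
Let E1r : right_id (aone E) (amul E). Proof. by case: E_alg. Qed.
Let Elr z : linear (amul E z). Proof. by case: E_alg => -[_ /(_ z)]. Qed.
Let Ell z : linear (fun w => amul E w z). Proof. by case: E_alg => -[/(_ z)]. Qed.
(* The next four are found in the context by [lin]. *)
Let Alr z : linear (amul A z). Proof. by case: A_bilinear => _ /(_ z). Qed.
Let All z : linear (fun w => amul A w z). Proof. by case: A_bilinear => /(_ z). Qed.
Let Blr z : linear (amul B z). Proof. by case: B_alg => -[_ /(_ z)]. Qed.
Let Bll z : linear (fun w => amul B w z). Proof. by case: B_alg => -[/(_ z)]. Qed.

Let m_inj : injective m := bij_inj m_bij.

Let m_tsum (t : tens V W) : m t = \sw_(a, b <- t) amul E (j a) (i b).
Proof.
rewrite -[t in LHS]tsum_tpure (linear_tsumE _ _ (linear_lfunr m)).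
by apply: eq_tsum => a b; rewrite mE.
Qed.

(** As [m] is injective, each axiom is checked in [E], where [mR] reads R(b \ox a) as i(b)j(a); the
    axioms become unit and associativity laws of [E]. *)
Lemma twisting_map_of_factorization : is_twisting_map A B R.
Proof.
split=> [a|b|a a' b|a b b']; apply: m_inj.
- by rewrite mR mE i1 E1l E1r.
- by rewrite mR mE j1 E1l E1r.
- rewrite mR jM EA -mR m_tsum (linear_tsumE _ _ (Ell (j a'))).
  rewrite (linear_tsumE _ _ (linear_lfunr m)); apply: eq_tsum => aR bR.
  rewrite -EA -mR m_tsum (linear_tsumE _ _ (Elr (j aR))).
  rewrite (linear_tsumE _ _ (linear_lfunr m)); apply: eq_tsum => a'r bRr.
  by rewrite mE jM EA.
rewrite mR iM -EA -mR m_tsum (linear_tsumE _ _ (Elr (i b))).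
rewrite (linear_tsumE _ _ (linear_lfunr m)); apply: eq_tsum => aR b'R.
rewrite EA -mR m_tsum (linear_tsumE _ _ (Ell (i b'R))).
rewrite (linear_tsumE _ _ (linear_lfunr m)); apply: eq_tsum => aRr br.
by rewrite mE iM EA.
Qed.

Let T := twisted_tensor A B R.

Let T_bilinear : bilinear_for *:%R *:%R (amul T).
Proof.
by split=> z; rewrite /= /applyr; lin. Qed.

(** In j(a)i(b)j(a')i(b') the inner product i(b)j(a') is put in the order j, i by [R]. *)
Let mM : {morph m : x y / amul T x y >-> amul E x y}.
Proof.
have Tl z : linear (fun x => amul T x z) by case: T_bilinear => /(_ z).
have Tr z : linear (amul T z) by case: T_bilinear => _ /(_ z).
move=> x y; elim/tens_ind: x => [a b|c x x' IHx IHx']; last first.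
  by rewrite (linear_lfunr m) (Ell (m y)) (Tl y) (linear_lfunr m) IHx IHx'.
elim/tens_ind: y => [a' b'|c y y' IHy IHy']; last first.
  by rewrite (linear_lfunr m) (Elr (m _)) (Tr _) (linear_lfunr m) IHy IHy'.
rewrite twisted_tensorE //.
rewrite !mE EA -[amul E (amul E (j a) _) _]EA -mR [m (R _)]m_tsum.
rewrite (linear_tsumE _ _ (Elr (j a))) (linear_tsumE _ _ (Ell (i b'))).
rewrite (linear_tsumE _ _ (linear_lfunr m)); apply: eq_tsum => a'R bR.
by rewrite mE jM iM !EA.
Qed.

Lemma alg_iso_of_factorization : is_alg_iso T E m.
Proof.
have m1 : m (aone T) = aone E by rewrite mE j1 i1 E1l.
by split=> //; apply: is_algebra_inj T_bilinear E_alg m_inj m1 mM.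
Qed.

(** Up to the unit of [E], [j] is [m] restricted to A \ox 1, hence injective because 1 is nonzero in
    [B]; so [A] inherits the laws of [E]. *)
Lemma is_algebra_of_factorization : is_algebra A.
Proof.
apply: (is_algebra_inj A_bilinear E_alg _ j1 jM).
apply: raddf_inj => a ja0; apply/eqP; apply: contraT => a_neq0.
have /negP[] := tpure_neq0 a_neq0 B1_neq0.
apply/eqP/m_inj; rewrite mE ja0 raddf0 -[0 in LHS](scale0r (0 : D)).
by rewrite (linear_scaleE _ _ (Ell _)) scale0r.
Qed.

End TwistedTensorRecognition.

(** * The action of H \ox H on H^* \ox H *)

Section DoubleIso.
Variables (k : fieldType) (H : finHopfAlgType k).
Implicit Types (f g : dual H) (h : H) (s t : tens H H) (x : tens (dual H) H).
Local Notation S' := (@antipodeV k H).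

(** S^-1 is antimultiplicative and ↼ is a right action, so together they give a left action;
    invertible elements therefore act bijectively. *)
Lemma double_isoM s t x : double_iso (s * t) x = double_iso s (double_iso t x).
Proof.
rewrite -comp_lfunE; move: x; apply: eq_on_pure => f h.
rewrite comp_lfunE !double_isoE (linear_tsumE _ _ (linear_lfunr _)).
rewrite tsum_tensM; mlin; rewrite exchange_tsum; apply: eq_tsum => a' b'.
rewrite double_isoE; apply: eq_tsum => a b.
by rewrite antipodeVM rhitM mulrA.
Qed.

Lemma double_iso1 x : double_iso 1 x = x.
Proof.
rewrite -[RHS](id_lfunE x); move: x; apply: eq_on_pure => f h.
rewrite id_lfunE double_isoE tsum_pure; mlin.
by rewrite antipodeV1 rhit1 mul1r.
Qed.

Lemma double_iso_bij s : s \is a GRing.unit -> bijective (double_iso s).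
Proof.
move=> s_unit; exists (double_iso s^-1) => x.
  by rewrite -double_isoM mulVr ?double_iso1.
by rewrite -double_isoM mulrV ?double_iso1.
Qed.

(** The factors u^1 and u^2 of R' form the action of the inverse, which [double_iso s] cancels when
    [s] is a unit. *)
Lemma double_twistE_iso s h f :
  double_twist s (h \ox f) = double_iso s^-1
    (\sw_(h1, h2, h3 <- comul3 h) \sw_(r1, r2 <- s)
       (h1 ⇀ f ↼ S' (h3 * r1)) \ox (h2 * r2)).
Proof.
rewrite double_twistE (linear_tsumE _ _ (linear_lfunr _)); apply: eq_tsum => h1 h'.
rewrite (linear_tsumE _ _ (linear_lfunr _)); apply: eq_tsum => h2 h3.
rewrite (linear_tsumE _ _ (linear_lfunr _)) exchange_tsum; apply: eq_tsum => r1 r2.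
rewrite double_isoE; apply: eq_tsum => u1 u2.
by rewrite rhitM -antipodeVM !mulrA.
Qed.

End DoubleIso.

(** * The copy of H^* inside the double given by r *)

Section TwistedDual.
Variables (k : fieldType) (H : finHopfAlgType k) (r : tens H H).
Implicit Types (U : vectType k) (f g : dual H) (h x y : H).
Local Notation S' := (@antipodeV k H).

Hypothesis r_unit : r \is a GRing.unit.
Hypothesis comul_r1 :
  \sw_(r1, r2 <- r) \sw_(r11, r12 <- comul r1) r11 \ox r12 \ox r2 =
  \sw_(R1, R2 <- r) \sw_(r1, r2 <- r) R1 \ox r1 \ox (R2 * r2).
Hypothesis comul_r2 :
  \sw_(r1, r2 <- r) \sw_(r21, r22 <- comul r2) r1 \ox r21 \ox r22 =
  \sw_(R1, R2 <- r) \sw_(r1, r2 <- r) (R1 * r1) \ox r2 \ox R2.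
Hypothesis r_comul :
  \sw_(R1, R2 <- r) \sw_(R21, R22 <- comul R2) \sw_(r1, r2 <- r)
    R1 \ox (R22 * r1) \ox (R21 * r2) =
  \sw_(R1, R2 <- r) \sw_(R21, R22 <- comul R2) \sw_(r1, r2 <- r)
    R1 \ox (r1 * R21) \ox (r2 * R22).

Section Trilinear.
Variables (U : vectType k) (F : H -> H -> H -> U).
Hypothesis F1 : forall b c, linear (fun a => F a b c).
Hypothesis F2 : forall a c, linear (fun b => F a b c).
Hypothesis F3 : forall a b, linear (F a b).

(** A shape shared by the three identities on r, under an outer sum for the third: [a], [b], [c]
    give the legs in terms of the Sweedler components. *)
Let tsumF (t : tens H H) (s : H -> H -> tens H H) (a b c : H -> H -> H -> H -> H) :
  \sw_(x, y, z <- \sw_(v, w <- t) \sw_(v', w' <- s v w)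
     a v w v' w' \ox b v w v' w' \ox c v w v' w') F x y z =
  \sw_(v, w <- t) \sw_(v', w' <- s v w)
     F (a v w v' w') (b v w v' w') (c v w v' w').
Proof.
rewrite tsum_tsum; apply: eq_tsum => v w; rewrite tsum_tsum.
by apply: eq_tsum => v' w'; rewrite tsum_pure3.
Qed.

Lemma tsum_comul_r1 :
  \sw_(r1, r2 <- r) \sw_(r11, r12 <- comul r1) F r11 r12 r2 =
  \sw_(R1, R2 <- r) \sw_(r1, r2 <- r) F R1 r1 (R2 * r2).
Proof.
by have := congr1 (fun t => \sw_(a, b, c <- t) F a b c) comul_r1; rewrite !tsumF.
Qed.

Lemma tsum_comul_r2 :
  \sw_(r1, r2 <- r) \sw_(r21, r22 <- comul r2) F r1 r21 r22 =
  \sw_(R1, R2 <- r) \sw_(r1, r2 <- r) F (R1 * r1) r2 R2.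
Proof.
by have := congr1 (fun t => \sw_(a, b, c <- t) F a b c) comul_r2; rewrite !tsumF.
Qed.

Lemma tsum_r_comul :
  \sw_(R1, R2 <- r) \sw_(R21, R22 <- comul R2) \sw_(r1, r2 <- r)
    F R1 (R22 * r1) (R21 * r2) =
  \sw_(R1, R2 <- r) \sw_(R21, R22 <- comul R2) \sw_(r1, r2 <- r)
    F R1 (r1 * R21) (r2 * R22).
Proof.
have := congr1 (fun t => \sw_(a, b, c <- t) F a b c) r_comul; rewrite !tsum_tsum.
under eq_tsum => R1 R2 do rewrite (tsumF (comul R2) (fun _ _ => r)).
by under [X in _ = X -> _]eq_tsum => R1 R2 do rewrite (tsumF (comul R2) (fun _ _ => r)).
Qed.

End Trilinear.

(** Applying ε \ox id \ox id to the first identity gives r = (1 \ox e)r with e = ε(r^1)r^2, and the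
    unit r cancels. *)
Lemma counit_r1 : \sw_(r1, r2 <- r) (counit r1 *: r2) = 1.
Proof.
set e := tsum _ _.
have er : r = (1 \ox e) * r.
  rewrite -[LHS](tsum_tpure r).
  transitivity (\sw_(r1, r2 <- r) \sw_(a, b <- comul r1) (counit a *: (b \ox r2))).
    by apply: eq_tsum => r1 r2; rewrite (tsum_counitl (F := fun b => b \ox r2)); mlin.
  rewrite (tsum_comul_r1 (F := fun a b c => counit a *: (b \ox c))); mlin.
  rewrite /e (linear_tsumE _ _ (linear_tpurer 1)).
  rewrite (linear_tsumE _ _ (linear_mull r)); apply: eq_tsum => R1 R2.
  rewrite linearZr_LR -scalerAl -[in RHS](tsum_tpure r).
  rewrite (linear_tsumE _ _ (linear_mulr _)) scaler_tsum; apply: eq_tsum => r1 r2.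
  by rewrite tens_purM mul1r.
have : 1 \ox 1 = 1 \ox e :> tens H H by apply: (mulIr r_unit); rewrite -er; apply: mul1r.
move/(congr1 (fun t : tens H H => \sw_(a, b <- t) (counit a *: b))).
by rewrite !tsum_pure; mlin; rewrite rmorph1 !scale1r.
Qed.

Let D := drinfeld_double H.
Let j f := double_iso r (f \ox 1).

Let jE f : j f = \sw_(r1, r2 <- r) (f ↼ S' r1) \ox r2.
Proof. by rewrite /j double_isoE; apply: eq_tsum => r1 r2; rewrite mulr1. Qed.

Let Dl z : linear (fun w => amul D w z).
Proof. by have [/(_ z)] := drinfeld_double_bilinear H. Qed.
Let Dr z : linear (amul D z).
Proof. by have [_ /(_ z)] := drinfeld_double_bilinear H. Qed.

Lemma double_iso_factor f h :
  double_iso r (f \ox h) = amul D (j f) (conv_one H \ox h).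
Proof.
rewrite jE double_isoE (linear_tsumE _ _ (Dl _)); apply: eq_tsum => r1 r2.
by rewrite drinfeld_doubleMr.
Qed.

Lemma double_iso_conv_one : j (conv_one H) = conv_one H \ox 1.
Proof.
rewrite jE -counit_r1 (linear_tsumE _ _ (linear_tpurer _)); apply: eq_tsum => r1 r2.
by rewrite rhit_conv_one counit_antipodeV linearZl_LR linearZr_LR.
Qed.

(** After r^-1 is cancelled, what remains is the product of the double for ε \ox h and j(f). *)
Lemma double_iso_twist f h :
  double_iso r (double_twist r (h \ox f)) = amul D (conv_one H \ox h) (j f).
Proof.
rewrite double_twistE_iso -double_isoM divrr // double_iso1 jE.
rewrite (linear_tsumE _ _ (Dr _)).
under [RHS]eq_tsum => r1 r2 do rewrite drinfeld_doubleE.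
rewrite [RHS]exchange_tsum; apply: eq_tsum => h1 h'.
rewrite [RHS]exchange_tsum; apply: eq_tsum => h2 h3.
by apply: eq_tsum => r1 r2; rewrite conv1f -hitA rhitM -antipodeVM.
Qed.

Lemma double_iso_conv f g : j (amul (underlined_dual r) f g) = amul D (j f) (j g).
Proof.
pose Phi (w x y z : H) := conv (f ↼ S' w) (x ⇀ g ↼ S' y) \ox z.
(* Left side: S^-1(R^1) distributes over the convolution with its parts swapped, then the first
   identity replaces Δ(R^1). *)
transitivity (\sw_(r1, r2 <- r) \sw_(a, b <- comul r2) \sw_(R1, R2 <- r)
   \sw_(T1, T2 <- r) Phi (T1 * r1) a (R1 * b) (R2 * T2)).
  rewrite /j /=.
  rewrite (linear_tsumE _ _ (linear_tpurel 1)) (linear_tsumE _ _ (linear_lfunr _)).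
  apply: eq_tsum => r1 r2.
  rewrite (linear_tsumE _ _ (linear_tpurel 1)) (linear_tsumE _ _ (linear_lfunr _)).
  apply: eq_tsum => a b; rewrite -/(j _) jE.
  rewrite -(tsum_comul_r1 (F := fun p q R2 => Phi (q * r1) a (p * b) R2));
    try by rewrite /Phi; mlin.
  apply: eq_tsum => R1 R2; rewrite rhit_conv tsum_comul_antipodeV; mlin.
  rewrite (linear_tsumE _ _ (linear_tpurel _)); apply: eq_tsum => p q.
  by rewrite !rhitM -!antipodeVM.
(* Right side: the product j(f)j(g) expanded in the double. *)
transitivity (\sw_(r1, r2 <- r) \sw_(R1, R2 <- r) \sw_(a, b', c' <- comul3 r2)
   Phi r1 a (c' * R1) (b' * R2)); last first.
  rewrite !jE (linear_tsumE _ _ (Dl _)); apply: eq_tsum => r1 r2.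
  rewrite (linear_tsumE _ _ (Dr _)); apply: eq_tsum => R1 R2.
  rewrite drinfeld_doubleE; apply: eq_tsum => a b'; apply: eq_tsum => b c.
  by rewrite -hitA rhitM -antipodeVM.
(* The second identity merges two copies of r into one whose second leg is split in three. *)
transitivity (\sw_(r1, r2 <- r) \sw_(a, y <- comul r2) \sw_(b, c <- comul y)
    \sw_(R1, R2 <- r) Phi r1 a (R1 * b) (R2 * c)).
  under [RHS]eq_tsum => r1 r2 do [rewrite tsum_comulA; first last;
    try by rewrite /Phi; mlin].
  rewrite (tsum_comul_r2 (F := fun w y c => \sw_(a, b <- comul y)
    \sw_(R1, R2 <- r) Phi w a (R1 * b) (R2 * c))); try by rewrite /Phi; mlin.
  rewrite [RHS]exchange_tsum; apply: eq_tsum => r1 r2.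
  rewrite [RHS]exchange_tsum; apply: eq_tsum => a b.
  by rewrite [RHS]exchange_tsum.
(* Splitting at the other place isolates a comultiplied second leg multiplied by a copy of r, as in
   the third identity. *)
rewrite (tsum_comul_r2 (F := fun w a y => \sw_(b, c <- comul y)
  \sw_(R1, R2 <- r) Phi w a (R1 * b) (R2 * c))); try by rewrite /Phi; mlin.
rewrite exchange_tsum.
(* The third identity moves that copy of r to the right and swaps b and c; the second identity then
   merges back. *)
under eq_tsum => r1 r2 do [rewrite -(tsum_r_comul
  (F := fun w y z => Phi (w * r1) r2 y z)); try by rewrite /Phi; mlin].
rewrite exchange_tsum -(tsum_comul_r2 (F := fun w a y => \sw_(b, c <- comul y)
  \sw_(R1, R2 <- r) Phi w a (c * R1) (b * R2))); try by rewrite /Phi; mlin.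
apply: eq_tsum => r1 r2; rewrite [RHS]exchange_tsum.
under [RHS]eq_tsum => a t do rewrite exchange_tsum.
by rewrite tsum_comul3; try by rewrite /Phi; mlin.
Qed.

Lemma underlined_dual_bilinear : bilinear_for *:%R *:%R (amul (underlined_dual r)).
Proof. by split=> f; rewrite /= /applyr; lin. Qed.

End TwistedDual.

Lemma falg_is_algebra (k : fieldType) (A : falgType k) : is_algebra (falg_ops A).
Proof.
split=> /=; [split=> x|exact: mulrA|exact: mul1r|exact: mulr1].
  exact: linear_mull.
exact: linear_mulr.
Qed.

Theorem mainTheorem1 (k : fieldType) (H : finHopfAlgType k) (r : tens H H)
    (r_unit : r \is a GRing.unit)
    (comul_r1 :
      \sw_(r1, r2 <- r) \sw_(r11, r12 <- comul r1) r11 \ox r12 \ox r2 =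
      \sw_(R1, R2 <- r) \sw_(r1, r2 <- r) R1 \ox r1 \ox (R2 * r2))
    (comul_r2 :
      \sw_(r1, r2 <- r) \sw_(r21, r22 <- comul r2) r1 \ox r21 \ox r22 =
      \sw_(R1, R2 <- r) \sw_(r1, r2 <- r) (R1 * r1) \ox r2 \ox R2)
    (r_comul :
      \sw_(R1, R2 <- r) \sw_(R21, R22 <- comul R2) \sw_(r1, r2 <- r)
        R1 \ox (R22 * r1) \ox (R21 * r2) =
      \sw_(R1, R2 <- r) \sw_(R21, R22 <- comul R2) \sw_(r1, r2 <- r)
        R1 \ox (r1 * R21) \ox (r2 * R22)) :
  [/\ is_algebra (underlined_dual r),
      is_twisting_map (underlined_dual r) (falg_ops H) (double_twist r),
      is_alg_iso
        (twisted_tensor (underlined_dual r) (falg_ops H) (double_twist r))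
        (drinfeld_double H) (double_iso r)
    & exists (R : 'Hom(tens H (dual H), tens (dual H) H))
             (f : 'Hom(tens (dual H) H, tens (dual H) H)),
        is_twisting_map (underlined_dual r) (falg_ops H) R /\
        is_alg_iso (twisted_tensor (underlined_dual r) (falg_ops H) R)
          (drinfeld_double H) f].

Proof.
have Abil := underlined_dual_bilinear r.
have Balg := falg_is_algebra H.
have Ealg := drinfeld_double_is_algebra H.
have m_bij := double_iso_bij r_unit.
(* The inclusions of the two factors of D(H), bundled as linear maps for the factorization
   lemmas. *)
pose j : 'Hom(dual H, tens (dual H) H) := linfun (fun f => double_iso r (f \ox 1)).
pose i : 'Hom(H, tens (dual H) H) := linfun (fun h => conv_one H \ox h).
have jE f : j f = double_iso r (f \ox 1) by rewrite linfunE; mlin.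
have iE h : i h = conv_one H \ox h by rewrite linfunE; mlin.
have j1 : j (aone (underlined_dual r)) = aone (drinfeld_double H).
  by rewrite jE; apply: double_iso_conv_one r_unit comul_r1.
have i1 : i (aone (falg_ops H)) = aone (drinfeld_double H) by rewrite iE.
have jM : {morph j : x y /
    amul (underlined_dual r) x y >-> amul (drinfeld_double H) x y}.
  by move=> x y; rewrite !jE; apply: double_iso_conv comul_r1 comul_r2 r_comul _ _.
have iM : {morph i : x y / amul (falg_ops H) x y >-> amul (drinfeld_double H) x y}.
  by move=> x y; rewrite !iE drinfeld_doubleMr.
have mE f h : double_iso r (f \ox h) = amul (drinfeld_double H) (j f) (i h).
  by rewrite jE iE; apply: double_iso_factor.
have mR f h : double_iso r (double_twist r (h \ox f)) =
    amul (drinfeld_double H) (i h) (j f).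
  by rewrite jE iE; apply: double_iso_twist r_unit _ _.
have twisting : is_twisting_map (underlined_dual r) (falg_ops H) (double_twist r).
  exact: twisting_map_of_factorization mE mR.
have iso : is_alg_iso (twisted_tensor (underlined_dual r) (falg_ops H) (double_twist r))
    (drinfeld_double H) (double_iso r).
  exact: alg_iso_of_factorization mE mR.
split=> //; last by exists (double_twist r), (double_iso r).
(* Associativity of the new product on H^* is inherited from D(H) through [j]. *)
exact: (is_algebra_of_factorization (i := i) (m := double_iso r) (B := falg_ops H)
  (j := j) (oner_neq0 H) Abil Ealg m_bij).
Qed.
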